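(* Let $M\cong\mathbb{Z}^d$ be a lattice with $d\ge 1$. For a matrix $A\in\mathrm{Mat}_d(\mathbb{Z})$ with nonzero determinant and a lattice basis $m_1,\dots,m_d$ of $M$, let $P_A$ be the convex hull of the $2d$ points $\pm a_1,\dots,\pm a_d\in M\otimes\mathbb{R}$, where $a_j=\sum_i A_{i,j}m_i$ is the point whose coefficient vector in this basis is the $j$-th column of $A$. (1) The assignment $A\mapsto P_A$ induces a one-to-one correspondence between equivalence classes of Wirth matrices (in $\mathrm{Mat}_d(\mathbb{N})$) and isomorphism classes of $d$-dimensional reflexive cs-crosspolytopes. For the inverse map: given any facet of a reflexive cs-crosspolytope $P$, there is a lattice basis of $M$ in which the coordinate vectors of the vertices of this facet are the columns of a Wirth matrix corresponding to $P$. (2) Under this correspondence, equivalence classes of 1-minimal Wirth matrices correspond to isomorphism classes of 1-irreducible reflexive cs-crosspolytopes. Moreover, any reflexive cs-crosspolytope $P$ splits, uniquely up to isomorphism, into a 1-irreducible reflexive cs-crosspolytope $P'$ and $r$ copies of $[-1,1]$; here a 1-minimal Wirth matrix associated to $P'$ is the reduction of a Wirth matrix $A$ associated to $P$, and $r$ equals the number of rows of $A$ containing only one entry equal to $1$.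
   Context: $M\cong\mathbb{Z}^d$ and $N=\mathrm{Hom}_{\mathbb{Z}}(M,\mathbb{Z})$ are dual lattices with pairing $\langle\cdot,\cdot\rangle$; $M_{\mathbb{R}}=M\otimes\mathbb{R}$, $N_{\mathbb{R}}=N\otimes\mathbb{R}$. A Fano polytope is a $d$-dimensional lattice polytope $P\subseteq M_{\mathbb{R}}$ with $0$ in its interior and primitive vertices. Its dual is $P^*=\{x\in N_{\mathbb{R}}:\langle x,y\rangle\ge -1\ \forall y\in P\}$; $P$ is reflexive if $P^*$ is a lattice polytope. Two lattice polytopes are isomorphic if some lattice automorphism maps the vertex set of one onto that of the other. A cs-crosspolytope is the convex hull of a simplex not containing $0$ together with its negative (equivalently a $d$-dimensional simplicial polytope with $2d$ vertices having a facet $F$ with $-F$ also a facet). A Wirth matrix is a matrix $A=\begin{pmatrix}2\,\mathrm{id}_f&0\\ C&\mathrm{id}_{d-f}\end{pmatrix}\in\mathrm{Mat}_d(\mathbb{N})$ with $f\in\{0,\dots,d-1\}$ and $C\in\mathrm{Mat}_{(d-f)\times f}(\{0,1\})$ such that every column of $C$ has an odd number of $1$'s. It is 1-minimal if every row of $C$ contains a $1$. The reduction of a Wirth matrix is the 1-minimal Wirth matrix obtained by deleting each row containing only one $1$ (i.e. a row among the last $d-f$ whose part in $C$ is zero) together with the column containing that row's diagonal $1$. Two matrices in $\mathrm{Mat}_d(\mathbb{N})$ are equivalent if they differ by a permutation of columns and left multiplication by a matrix in $\mathrm{GL}_d(\mathbb{Z})$. For Fano polytopes $P_1\subseteq (M_1)_{\mathbb{R}}$,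 $P_2\subseteq (M_2)_{\mathbb{R}}$ with $\dim P_1+\dim P_2=d$, $P$ splits into factors $P_1$ and $P_2$ if $P\cong\mathrm{conv}(P_1\oplus\{0\},\{0\}\oplus P_2)$ under some isomorphism $M\cong M_1\oplus M_2$ (iterating gives splitting into several factors). $P$ is 1-irreducible if $P$ does not split into $[-1,1]$ and some $P_2$. *)

(* Defs.v *)
From HB Require Import structures.
From mathcomp Require Import all_boot all_order all_algebra.
From mathcomp Require Import fingroup perm reals.
Set Implicit Arguments. Unset Strict Implicit. Unset Printing Implicit Defensive.
Import Order.TTheory GRing.Theory Num.Theory.
Local Open Scope ring_scope.

(* The lattice M is Z^n (column vectors 'cV[int]_n), M_R = 'cV[R]_n;
   N = Z^n with the standard pairing (dual basis), N_R = 'cV[R]_n. *)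

Section Geometry.
Variable R : realType.

Definition toR {m n} (A : 'M[int]_(m, n)) : 'M[R]_(m, n) :=
  map_mx (fun z : int => z%:~R) A.

Definition pair {n} (x y : 'cV[R]_n) : R := \sum_i x i 0 * y i 0.

Definition conv_set {n} (S : 'cV[R]_n -> Prop) (x : 'cV[R]_n) : Prop :=
  exists k (p : 'I_k -> 'cV[R]_n) (w : 'I_k -> R),
    (forall i, S (p i)) /\ (forall i, 0 <= w i) /\ \sum_i w i = 1 /\
    x = \sum_i w i *: p i.

Definition conv_pts {n} (s : seq 'cV[R]_n) := conv_set (fun y => y \in s).

Definition same {n} (P Q : 'cV[R]_n -> Prop) := forall x, P x <-> Q x.

Definition lattice_polytope {n} (P : 'cV[R]_n -> Prop) :=
  exists s : seq 'cV[int]_n, same P (conv_pts (map toR s)).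

Definition zero_interior {n} (P : 'cV[R]_n -> Prop) :=
  exists e : R, 0 < e /\ forall x : 'cV[R]_n, (forall i, `|x i 0| <= e) -> P x.

Definition vertex {n} (P : 'cV[R]_n -> Prop) (x : 'cV[R]_n) :=
  P x /\ forall y z (t : R), P y -> P z -> 0 < t < 1 ->
    x = t *: y + (1 - t) *: z -> y = z.

Definition primitive {n} (v : 'cV[int]_n) :=
  forall (k : int) (w : 'cV[int]_n), v = k *: w -> k = 1 \/ k = -1.

(* Fano polytope: lattice polytope, 0 in the interior (hence full-dimensional),
   primitive vertices.  (Nonzero vertices: in dimension >= 1 a vertex is never 0;
   the restriction only matters for the 0-dimensional polytope {0}.) *)
Definition Fano {n} (P : 'cV[R]_n -> Prop) :=
  lattice_polytope P /\ zero_interior P /\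
  forall x, vertex P x -> x != 0 -> exists v, x = toR v /\ primitive v.

Definition dual {n} (P : 'cV[R]_n -> Prop) : 'cV[R]_n -> Prop :=
  fun x => forall y, P y -> -1 <= pair x y.

Definition is_reflexive {n} (P : 'cV[R]_n -> Prop) :=
  Fano P /\ lattice_polytope (dual P).

(* P_A : convex hull of +- the columns of A (0 is added to the point list,
   which changes nothing for n >= 1 and gives {0} for n = 0). *)
Definition Pmx {n} (A : 'M[int]_n) : 'cV[R]_n -> Prop :=
  conv_pts (0 :: [seq toR (col j A) | j <- enum 'I_n]
              ++ [seq - toR (col j A) | j <- enum 'I_n]).

(* cs-crosspolytope: convex hull of the simplex with n linearly independent
   (lattice) vertices v_1..v_n (columns of V, det V != 0) and its negative. *)
Definition cs_cross {n} (P : 'cV[R]_n -> Prop) :=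
  exists V : 'M[int]_n, \det V != 0 /\ same P (Pmx V).

Definition iso {n m} (P : 'cV[R]_n -> Prop) (Q : 'cV[R]_m -> Prop) :=
  exists (U : 'M[int]_(m, n)) (V : 'M[int]_(n, m)),
    V *m U = 1%:M /\ U *m V = 1%:M /\
    (forall x, vertex P x -> vertex Q (toR U *m x)) /\
    (forall y, vertex Q y -> exists x, vertex P x /\ y = toR U *m x).

Definition facet {n} (P F : 'cV[R]_n -> Prop) :=
  (exists (u : 'cV[R]_n) (c : R), u != 0 /\
     (forall y, P y -> c <= pair u y) /\
     (forall x, F x <-> (P x /\ pair u x = c))) /\
  (exists p : 'I_n -> 'cV[R]_n, (forall i, F (p i)) /\
     forall c : 'I_n -> R, \sum_i c i = 0 -> \sum_i c i *: p i = 0 ->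
       forall i, c i = 0).

Definition freesum {n1 n2} (P1 : 'cV[R]_n1 -> Prop) (P2 : 'cV[R]_n2 -> Prop)
  : 'cV[R]_(n1 + n2) -> Prop :=
  conv_set (fun x => (exists y, P1 y /\ x = col_mx y 0) \/
                     (exists z, P2 z /\ x = col_mx 0 z)).

Definition splits {n n1 n2} (P : 'cV[R]_n -> Prop)
  (P1 : 'cV[R]_n1 -> Prop) (P2 : 'cV[R]_n2 -> Prop) :=
  Fano P1 /\ Fano P2 /\ iso P (freesum P1 P2).

Definition seg : 'cV[R]_1 -> Prop :=
  conv_pts [:: const_mx 1; const_mx (-1)].

Definition one_irreducible {n} (P : 'cV[R]_n -> Prop) :=
  ~ exists n2 (Q : 'cV[R]_n2 -> Prop), splits P seg Q.

Inductive splits_segs : forall n, ('cV[R]_n -> Prop) ->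
    forall n', ('cV[R]_n' -> Prop) -> nat -> Prop :=
| splits_segs0 n (P : 'cV[R]_n -> Prop) n' (P' : 'cV[R]_n' -> Prop) :
    iso P P' -> splits_segs P P' 0
| splits_segsS n (P : 'cV[R]_n -> Prop) n2 (Q : 'cV[R]_n2 -> Prop)
    n' (P' : 'cV[R]_n' -> Prop) r :
    splits P seg Q -> splits_segs Q P' r -> splits_segs P P' r.+1.

End Geometry.

Section Matrices.
(* Wirth matrices, represented in 'M[int]_n (entries in {0,1,2}). *)

Definition wirth_f {n} (A : 'M[int]_n) (f : nat) :=
  (f < n)%N /\
  (forall i j : 'I_n, (i < f)%N -> A i j = (if i == j then 2 else 0)) /\
  (forall i j : 'I_n, (f <= i)%N -> (f <= j)%N -> A i j = (i == j)%:R) /\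
  (forall i j : 'I_n, (f <= i)%N -> (j < f)%N -> A i j = 0 \/ A i j = 1) /\
  (forall j : 'I_n, (j < f)%N ->
     odd #|[set i : 'I_n | (f <= i)%N && (A i j == 1)]|).

Definition wirth {n} (A : 'M[int]_n) := exists f, wirth_f A f.

Definition wirth_1min {n} (A : 'M[int]_n) :=
  exists f, wirth_f A f /\
    forall i : 'I_n, (f <= i)%N -> exists j : 'I_n, (j < f)%N /\ A i j = 1.

Definition mx_equiv {n} (A A' : 'M[int]_n) :=
  exists (U : 'M[int]_n) (s : {perm 'I_n}), U \in unitmx /\ A' = U *m A *m perm_mx s.

Definition single_one {n} (A : 'M[int]_n) (i : 'I_n) :=
  #|[set j | A i j == 1]| == 1%N.

Definition kept {n} (A : 'M[int]_n) : {set 'I_n} := [set i | ~~ single_one A i].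

Definition num_single {n} (A : 'M[int]_n) : nat := #|[set i | single_one A i]|.

(* reduction: delete the rows with a single 1 and the columns of their
   diagonal 1 (i.e. the columns with the same index) *)
Definition reduction {n} (A : 'M[int]_n) : 'M[int]_#|kept A| :=
  \matrix_(i, j) A (enum_val i) (enum_val j).

End Matrices.

Arguments Pmx R {n} A.
Arguments toR R {m n} A.
Arguments seg R.

(* Main.v *)
Require Import Defs.
From HB Require Import structures.
From mathcomp Require Import all_boot all_order all_algebra.
From mathcomp Require Import fingroup perm reals.
From mathcomp Require Import zify ring lra.
Set Implicit Arguments. Unset Strict Implicit. Unset Printing Implicit Defensive.
Import Order.TTheory GRing.Theory Num.Theory.
Local Open Scope ring_scope.

(** The vertices of the dual of [P_V] are the vectors [x] with [x^T V] a sign vector, so [P_V]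
    is reflexive iff [2 V^-1] is integral and some integral row [u] satisfies [u V = (1,...,1)];
    primitivity of the columns is then automatic. In coordinates with respect to the columns of
    [V] the lattice lies between [Z^d] and [1/2 Z^d], hence is a binary linear code, namely
    [ker (V mod 2)], and the condition on [u] says that all codewords have even weight. Sign
    changes of the vertices act trivially mod 2, so isomorphism of reflexive cs-crosspolytopes is
    permutation equivalence of even codes. A Wirth matrix is a parity-check matrix in systematic
    form, which every code has up to a permutation of the coordinates. Splitting off [-1,1] means
    deleting a coordinate on which the code vanishes, i.e. a row of the Wirth matrix with a
    single 1, and zero coordinates can be cancelled up to permutation. *)

(** * Reflexive matrices *)

(** The code is the kernel of [V] mod 2 and equally the column span of [2 V^-1] mod 2: if
    [V x = 2 y], then [x = 2 V^-1 y]. Carrying [W = 2 V^-1] as an integral matrix therefore supplies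
    codewords explicitly and keeps the algebra over the integers. In a Wirth matrix the columns of
    [C] extend unit vectors to generators of the code, so an odd number of 1's in such a column is
    even weight of the generator. A facet of a crosspolytope only chooses one vertex from each
    opposite pair; as sign changes preserve reflexivity, a Wirth form is available at every facet.
    The reduction of the identity matrix is empty, so dimension 0 has to be allowed; there the point
    0 is a vertex, which explains the side conditions about 0. *)

Definition modF2 {m n} (A : 'M[int]_(m, n)) : 'M['F_2]_(m, n) := map_mx intr A.

Lemma modF2M m n p (A : 'M[int]_(m, n)) (B : 'M[int]_(n, p)) :
  modF2 (A *m B) = modF2 A *m modF2 B.
Proof. exact: map_mxM. Qed.

Lemma intrF2_eq0 (z : int) : (z%:~R == 0 :> 'F_2) = (2 %| z)%Z.
Proof. by rewrite (dvdz_pcharf (pchar_Fp (isT : prime 2))). Qed.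

Lemma modF2_eq0 m n (A : 'M[int]_(m, n)) :
  modF2 A = 0 -> exists B, A = 2 *: B.
Proof.
move=> A0; exists (\matrix_(i, j) (A i j %/ 2)%Z).
apply/matrixP => i j; rewrite !mxE mulrC divzK // -intrF2_eq0.
by move/matrixP/(_ i j): A0; rewrite !mxE => ->.
Qed.

Lemma modF2_scalar2 n : modF2 (2%:M : 'M_n) = 0.
Proof.
by apply/matrixP=> i j; rewrite !mxE; case: eqP => // _; apply/eqP; rewrite intrF2_eq0.
Qed.

Definition reflexive_witness n (V W : 'M[int]_n) (u : 'rV[int]_n) :=
  [/\ W *m V = 2%:M, V *m W = 2%:M & u *m V = const_mx 1].

Definition reflexive_mx n (V : 'M[int]_n) := exists W u, reflexive_witness V W u.

Lemma scalemx_inj m n (c : int) (A B : 'M[int]_(m, n)) :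
  c != 0 -> c *: A = c *: B -> A = B.
Proof.
move=> c0 e; apply/matrixP=> i j; move/matrixP/(_ i j): e; rewrite !mxE.
exact: mulfI.
Qed.

Lemma mulmx_left_inj m n (N N' : 'M[int]_(m, n)) (X W : 'M[int]_n) :
  X *m W = 2%:M -> N *m X = N' *m X -> N = N'.
Proof.
move=> XW /(congr1 (mulmx^~ W)); rewrite -!mulmxA XW !mul_mx_scalar.
exact: scalemx_inj.
Qed.

Lemma half_inverse_det n (V W : 'M[int]_n) : W *m V = 2%:M -> \det V != 0.
Proof.
move/(congr1 determinant); rewrite det_mulmx det_scalar => e; apply/eqP => V0; move/eqP: e.
by rewrite V0 mulr0 eq_sym expf_eq0 andbF.
Qed.

Lemma half_inverseC n (V W : 'M[int]_n) : W *m V = 2%:M -> V *m W = 2%:M.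
Proof.
move=> WV; have : V *m W *m V = 2%:M *m V.
  by rewrite -mulmxA WV mul_mx_scalar mul_scalar_mx.
(* The adjugate stands in for the inverse, which need not be integral. *)
move/(congr1 (mulmx^~ (\adj V))); rewrite -!(mulmxA _ V) mul_mx_adj !mul_mx_scalar.
exact: scalemx_inj (half_inverse_det WV).
Qed.

Lemma reflexive_det n (V : 'M[int]_n) : reflexive_mx V -> \det V != 0.
Proof. by case=> W [u [/half_inverse_det]]. Qed.

Lemma reflexive_unit_mul n (B V : 'M[int]_n) :
  B \in unitmx -> reflexive_mx V -> reflexive_mx (B *m V).
Proof.
move=> uB [W [u [WV VW uV]]]; exists (W *m invmx B), (u *m invmx B); split.
- by rewrite mulmxA -(mulmxA W) mulVmx // mulmx1.
- rewrite mulmxA -(mulmxA B) VW mul_mx_scalar -scalemxAl mulmxV //.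
  by rewrite scalemx1.
- by rewrite mulmxA -(mulmxA u) mulVmx // mulmx1.
Qed.

Lemma reflexive_witness_perm n (V W : 'M[int]_n) u (s : {perm 'I_n}) :
  reflexive_witness V W u ->
  reflexive_witness (V *m perm_mx s) (perm_mx s^-1 *m W) u.
Proof.
move=> [WV VW uV]; split.
- rewrite mulmxA -(mulmxA _ W) WV mul_mx_scalar -scalemxAl -perm_mxM.
  by rewrite mulVg perm_mx1 scalemx1.
- by rewrite mulmxA -(mulmxA V) -perm_mxM mulgV perm_mx1 mulmx1.
- rewrite mulmxA uV; apply/rowP => j; rewrite !mxE (bigD1 ((s^-1)%g j)) //=.
  rewrite !mxE permKV eqxx mulr1 big1 ?addr0 // => k kj.
  by rewrite !mxE mul1r; case: eqP => // e; move: kj; rewrite -e permK eqxx.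
Qed.

Lemma reflexive_perm n (V : 'M[int]_n) (s : {perm 'I_n}) :
  reflexive_mx V -> reflexive_mx (V *m perm_mx s).
Proof. by move=> [W [u h]]; do 2!eexists; exact: reflexive_witness_perm h. Qed.

(** Row [j] of [W] times [V] is twice the [j]-th unit row, so subtracting it from [u] flips the
    [j]-th sign: a single witness yields all dual vertices. *)
Lemma reflexive_sign_row n (V W : 'M[int]_n) u (e : 'I_n -> bool) :
  reflexive_witness V W u ->
  (u - (\row_j (e j)%:R) *m W) *m V = \row_j (-1) ^+ e j.
Proof.
case=> WV _ uV; rewrite mulmxBl uV -mulmxA WV mul_mx_scalar.
by apply/rowP=> j; rewrite !mxE; case: (e j).
Qed.

Lemma reflexive_sign n (V : 'M[int]_n) (e : 'I_n -> bool) :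
  reflexive_mx V -> reflexive_mx (V *m diag_mx (\row_j (-1) ^+ e j)).
Proof.
move=> [W [u h]]; have uV := reflexive_sign_row e h; case: h => WV VW _.
set D := diag_mx _.
have DD : D *m D = 1%:M.
  rewrite mulmx_diag; apply/matrixP=> i j; rewrite !mxE -expr2 sqrr_sign.
  by case: eqP.
exists (D *m W), (u - (\row_j (e j)%:R) *m W); split.
- by rewrite mulmxA -(mulmxA _ W) WV mul_mx_scalar -scalemxAl DD scalemx1.
- by rewrite mulmxA -(mulmxA V) DD mulmx1.
- rewrite mulmxA uV mul_mx_diag; apply/matrixP=> i j; rewrite !mxE.
  by rewrite -expr2 sqrr_sign.
Qed.

Lemma reflexive_block1 n (Y : 'M[int]_n) :
  reflexive_mx (block_mx (1%:M : 'M_1) 0 0 Y) <-> reflexive_mx Y.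
Proof.
split=> [[W [u [WV VW uV]]] | [W [u [WV VW uV]]]].
- exists (drsubmx W), (rsubmx u); split.
  + move: WV; rewrite -{1}(submxK W) mulmx_block ?mul0mx ?mulmx0 !addr0 !add0r.
    by rewrite scalar_mx_block => /eq_block_mx [_ _ _].
  + move: VW; rewrite -{1}(submxK W) mulmx_block ?mul0mx ?mulmx0 !addr0 !add0r.
    by rewrite scalar_mx_block => /eq_block_mx [_ _ _].
  + move: uV; rewrite -{1}(hsubmxK u) mul_row_block !mulmx0 !addr0 !add0r.
    by rewrite -row_mx_const => /eq_row_mx [].
- exists (block_mx 2%:M 0 0 W), (row_mx 1%:M u); split.
  + rewrite mulmx_block ?mul0mx ?mulmx0 !addr0 !add0r mulmx1 WV.
    by rewrite -scalar_mx_block.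
  + rewrite mulmx_block ?mul0mx ?mulmx0 !addr0 !add0r mul1mx VW.
    by rewrite -scalar_mx_block.
  + rewrite mul_row_block !mulmx0 !addr0 !add0r mul1mx uV -row_mx_const.
    by congr row_mx; apply/matrixP=> i j; rewrite !mxE !ord1.
Qed.

(* [ker (V mod 2)] determines the lattice spanned by the columns of [V^-1], hence [V]
   up to left multiplication by a unimodular matrix. *)
Lemma same_code_unit_mul n (X W X' W' : 'M[int]_n) u u' :
  reflexive_witness X W u -> reflexive_witness X' W' u' ->
  modF2 X *m modF2 W' = 0 -> modF2 X' *m modF2 W = 0 ->
  exists2 N, N \in unitmx & X' = N *m X.
Proof.
move=> [WX XW _] [WX' XW' _].
rewrite -!modF2M => /modF2_eq0 [N' eN'] /modF2_eq0 [N eN].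
(* Divisibility of [X' W] by 2 says that [X' X^-1] is integral; this quotient is [N]. *)
have NX : X' = N *m X.
  by apply: (@scalemx_inj _ _ 2) => //; rewrite scalemxAl -eN -mulmxA WX mul_mx_scalar.
have NX' : X = N' *m X'.
  by apply: (@scalemx_inj _ _ 2) => //; rewrite scalemxAl -eN' -mulmxA WX' mul_mx_scalar.
exists N => //; apply: (mulmx1_unit (B := N') _).1.
by apply: (mulmx_left_inj XW'); rewrite -mulmxA -NX' -NX mul1mx.
Qed.

Lemma same_kernel_unit_mul n (X X' : 'M[int]_n) :
  reflexive_mx X -> reflexive_mx X' ->
  (forall x : 'cV_n, modF2 X *m x = 0 <-> modF2 X' *m x = 0) ->
  exists2 N, N \in unitmx & X' = N *m X.
Proof.
move=> [W [u rX]] [W' [u' rX']] h.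
(* The columns of [Z] reduce to words of the code of [Y], so every [T] whose kernel contains that
   code kills them. *)
have aux (Y Z T : 'M[int]_n) : Y *m Z = 2%:M ->
    (forall x : 'cV_n, modF2 Y *m x = 0 -> modF2 T *m x = 0) -> modF2 T *m modF2 Z = 0.
  move=> YZ YT; apply/matrixP=> i j; rewrite [RHS]mxE.
  have := YT (col j (modF2 Z)); rewrite !colE !mulmxA -modF2M YZ modF2_scalar2 mul0mx.
  move=> /(_ erefl); rewrite -colE => /matrixP /(_ i 0).
  by rewrite !mxE.
case: (rX) (rX') => _ XW _ [_ XW' _].
by apply: (same_code_unit_mul rX rX'); [apply: aux XW' _ | apply: aux XW _] => x /h.
Qed.

Lemma same_modF2_unit_mul n (X X' : 'M[int]_n) :
  reflexive_mx X -> reflexive_mx X' -> modF2 X = modF2 X' ->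
  exists2 N, N \in unitmx & X' = N *m X.
Proof. by move=> rX rX' e; apply: same_kernel_unit_mul => // x; rewrite e. Qed.

Lemma mx_equiv_refl n (A : 'M[int]_n) : mx_equiv A A.
Proof. by exists 1%:M, 1%g; rewrite unitmx1 mul1mx perm_mx1 mulmx1. Qed.

Lemma mx_equiv_mull n (A B : 'M[int]_n) : B \in unitmx -> mx_equiv A (B *m A).
Proof. by move=> uB; exists B, 1%g; rewrite perm_mx1 mulmx1. Qed.

(** * Wirth matrices *)

(** Stated over any ring because the rows of a Wirth matrix from [f] on are used both over the
    integers and mod 2. *)
Lemma sum_unit_tail (S : nzRingType) n f (a x : 'I_n -> S) (i : 'I_n) : (f <= i)%N ->
  (forall k : 'I_n, (f <= k)%N -> a k = (i == k)%:R) ->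
  \sum_k a k * x k = \sum_(k < n | (k < f)%N) a k * x k + x i.
Proof.
move=> fi ha; rewrite (bigID (fun k : 'I_n => (k < f)%N)) /=; congr (_ + _).
rewrite (bigD1 i) /=; last by rewrite -leqNgt.
rewrite ha // eqxx mul1r big1 ?addr0 // => k /andP[fk ki].
by rewrite -leqNgt in fk; rewrite (ha k fk) eq_sym (negPf ki) mul0r.
Qed.

Lemma card_ones n f (A : 'M[int]_n) (j : 'I_n) :
  (forall i : 'I_n, (f <= i)%N -> A i j = 0 \/ A i j = 1) ->
  \sum_(i < n | (f <= i)%N) A i j = #|[set i : 'I_n | (f <= i)%N && (A i j == 1)]|%:R.
Proof.
move=> h; rewrite -sum1_card natr_sum [RHS]big_mkcond [LHS]big_mkcond /=.
apply: eq_bigr => i _; rewrite inE; case: leqP => //= fi.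
by case: (h i fi) => ->.
Qed.

(** This is [2 A^-1], in blocks [(id 0; -C 2 id)]; mod 2 only its first [f] columns survive, and
    they generate the code. *)
Definition wirth_half n (A : 'M[int]_n) f : 'M[int]_n :=
  \matrix_(i, j) if (i < f)%N then (i == j)%:R
                 else if (j < f)%N then - A i j else 2 * (i == j)%:R.

Lemma wirth_halfP n (A : 'M[int]_n) f : wirth_f A f -> A *m wirth_half A f = 2%:M.
Proof.
move=> [_ [A2 [A1 _]]]; apply/matrixP=> i j; rewrite !mxE.
have [fi|fi] := ltnP i f.
  rewrite (bigD1 i) //= big1 ?addr0 => [|k ki].
    by rewrite A2 // eqxx !mxE fi; case: eqP => // _; rewrite mulr0.
  by rewrite A2 // eq_sym (negPf ki) mul0r.
rewrite (@sum_unit_tail _ _ f _ _ i) //; last by move=> k fk; exact: A1.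
rewrite mxE ltnNge fi /=; have [jf|fj] := ltnP j f.
  rewrite (bigD1 j) //= big1 ?addr0 => [|k /andP[kf kj]].
    rewrite mxE jf eqxx mulr1 subrr; case: eqP => // ij.
    by move: jf; rewrite -ij ltnNge fi.
  by rewrite mxE kf (negPf kj) mulr0.
rewrite big1 ?add0r => [|k kf]; first by case: eqP.
rewrite mxE kf; case: eqP => [kj|]; last by rewrite mulr0.
by move: kf; rewrite kj ltnNge fj.
Qed.

Lemma wirth_reflexive_witness n (A : 'M[int]_n) f :
  wirth_f A f -> exists u, reflexive_witness A (wirth_half A f) u.
Proof.
move=> wA; have AW := wirth_halfP wA; case: (wA) => [_ [A2 [A1 [A01 Aodd]]]].
pose c (j : 'I_n) := #|[set i : 'I_n | (f <= i)%N && (A i j == 1)]|.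
(* In column [j < f] the rows from [f] on contribute the odd number [c j], and the diagonal 2
   contributes twice the entry of [u]; the sum is 1 exactly for the entry [- (c j)./2]. *)
exists (\row_j if (j < f)%N then - (c j)./2%:R else 1).
split=> //; first exact: half_inverseC.
apply/rowP=> j; rewrite !mxE (bigID (fun k : 'I_n => (k < f)%N)) /=.
have -> : \sum_(i < n | ~~ (i < f)%N)
    (\row_j (if (j < f)%N then - ((c j)./2%:R : int) else 1)) 0 i * A i j =
    \sum_(i < n | (f <= i)%N) A i j.
  by apply: eq_big => [i|i fi]; rewrite -?leqNgt // mxE (negPf fi) mul1r.
have [jf|fj] := ltnP j f.
  rewrite card_ones => [|i fi]; last exact: A01.
  rewrite (bigD1 j) //= big1 ?addr0 => [|k /andP[kf kj]].
    rewrite mxE jf A2 // eqxx -/(c j).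
    have := odd_double_half (c j); rewrite /c Aodd // -/(c j); lia.
  by rewrite A2 // (negPf kj) mulr0.
rewrite big1 ?add0r => [|k kf].
  rewrite (bigD1 j) //= big1 ?addr0 => [|k /andP[fk kj]].
    by rewrite A1 // eqxx.
  by rewrite A1 // (negPf kj).
rewrite A2 //; case: eqP => [kj|]; last by rewrite mulr0.
by move: kf; rewrite kj ltnNge fj.
Qed.

Lemma wirth_reflexive n (A : 'M[int]_n) : wirth A -> reflexive_mx A.
Proof.
by move=> [f /wirth_reflexive_witness [u h]]; exists (wirth_half A f), u.
Qed.

(** [s] reads off the list of the values of [g] followed by all other indices. It moves an
    information set to the front. *)
Lemma extend_injection f n (g : 'I_f -> 'I_n) : injective g ->
  exists s : {perm 'I_n}, forall (i : 'I_f) (k : 'I_n), k = i :> nat -> s k = g i.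
Proof.
move=> ig; pose L := codom g ++ enum [predC codom g].
have sL : size L = n.
  rewrite size_cat -cardE size_codom -(card_codom ig).
  by rewrite (cardC (mem (codom g))) card_ord.
have uL : uniq L.
  rewrite cat_uniq enum_uniq andbT /codom map_inj_uniq // enum_uniq /=.
  by apply/hasPn => x; rewrite mem_enum.
have is_ : injective (fun k : 'I_n => nth k L k).
  move=> k l /=; rewrite (set_nth_default l) ?sL // => /eqP.
  by rewrite nth_uniq ?sL // => /eqP /val_inj.
exists (perm is_) => i k ki; rewrite permE nth_cat size_codom card_ord ki ltn_ord.
by rewrite /codom (nth_map i) ?nth_ord_enum // size_enum_ord.
Qed.

Lemma F2P (x : 'F_2) : x = 0 \/ x = 1.
Proof. by case: x => [[|[|[|]]]] //= ?; [left|right]; apply: val_inj. Qed.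

Lemma natrF2 m : m%:R = (odd m)%:R :> 'F_2.
Proof.
have c2 : 2 \in [pchar 'F_2] by exact: pchar_Fp.
by rewrite -[in LHS](odd_double_half m) natrD -muln2 natrM (pcharf0 c2) mulr0 addr0.
Qed.

(* [W mod 2] spans the code [ker (V mod 2)]; a maximal set of independent rows of it is an
   information set, and the generator matrix in systematic form gives the Wirth matrix. *)
Lemma wirth_form n (V : 'M[int]_n) : (0 < n)%N -> reflexive_mx V ->
  exists B A (s : {perm 'I_n}), [/\ B \in unitmx, wirth A & V *m perm_mx s = B *m A].
Proof.
move=> n0 [W [u rV]]; case: (rV) => WV VW uV.
have c2 : 2 \in [pchar 'F_2] by exact: pchar_Fp.
pose Wb := modF2 W; pose f := \rank Wb; pose g : 'I_f -> 'I_n := maxrankfun Wb.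
pose T := rowsub g Wb.
have /row_freeP [S TS] : row_free T by exact: maxrowsub_free.
(* [G] has the same column span as [Wb] and is the identity on the rows chosen by [g]: the generator
   matrix in systematic form. *)
pose G := Wb *m S.
have WG : Wb = G *m T.
  have /submxP [D eD] : (Wb <= T)%MS by rewrite (eq_maxrowsub Wb).
  by rewrite /G {2}eD -(mulmxA D) TS mulmx1.
have Gg i j : G (g i) j = (i == j)%:R.
  have <- : (T *m S) i j = (i == j)%:R by rewrite TS mxE.
  by rewrite !mxE; apply: eq_bigr => k _; rewrite !mxE.
(* Even weight of the codewords: the all-one row is [u V], and [u V W = 2 u] vanishes mod 2. *)
have G1 j : \sum_k G k j = 0.
  have e : (const_mx 1 : 'rV[int]_n) *m W = 2 *: u.
    by rewrite -uV -mulmxA VW mul_mx_scalar.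
  have e1 : (const_mx 1 : 'rV['F_2]_n) *m Wb = 0.
    have -> : const_mx 1 = modF2 (const_mx 1 : 'rV[int]_n).
      by apply/rowP=> k; rewrite !mxE.
    rewrite /Wb -modF2M e.
    apply/matrixP=> i k; rewrite !mxE; apply/eqP; rewrite intrF2_eq0.
    exact: dvdz_mulr.
  have : ((const_mx 1 : 'rV['F_2]_n) *m G) 0 j = 0.
    by rewrite /G mulmxA e1 mul0mx mxE.
  by rewrite mxE; under eq_bigr do rewrite mxE mul1r.
have [s sg] := extend_injection (@maxrankfun_inj _ _ _ Wb : injective g).
have fn : (f <= n)%N by exact: rank_leq_row.
(* From [f] on, row [k] of [A] copies row [s k] of [G]; [insub] turns a column index below [f] into
   a column index of [G]. *)
pose A : 'M[int]_n := \matrix_(k, j) if (k < f)%N then (if k == j then 2 else 0) else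
  if insub (val j) is Some i then (G (s k) i != 0)%:R else (k == j)%:R.
have A2 (i j : 'I_n) : (i < f)%N -> A i j = (if i == j then 2 else 0) by rewrite mxE => ->.
have A1 (i j : 'I_n) : (f <= i)%N -> (f <= j)%N -> A i j = (i == j)%:R.
  by move=> fi fj; rewrite mxE ltnNge fi insubF // ltnNge fj.
have AG (k j : 'I_n) (i : 'I_f) : (f <= k)%N -> j = i :> nat ->
    A k j = (G (s k) i != 0)%:R.
  by move=> fk ji; rewrite mxE ltnNge fk (_ : \val j = \val i) ?valK.
have AGr (k j : 'I_n) (i : 'I_f) : (f <= k)%N -> j = i :> nat ->
    (A k j)%:~R = G (s k) i.
  by move=> fk ji; rewrite (AG _ _ i) //; case: (F2P (G (s k) i)) => ->.
have A01 (i j : 'I_n) : (f <= i)%N -> (j < f)%N -> A i j = 0 \/ A i j = 1.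
  move=> fi jf; rewrite (AG _ _ (Ordinal jf)) //.
  by case: (G _ _ != 0); [right | left].
have Aodd (j : 'I_n) : (j < f)%N -> odd #|[set i : 'I_n | (f <= i)%N && (A i j == 1)]|.
  move=> jf; pose j' := Ordinal jf.
  (* The rows chosen by [g] contribute exactly 1 to this zero sum, so the other rows contain an odd
     number of 1's. *)
  have : \sum_k G (s k) j' = 0 by rewrite -[RHS](G1 j') [RHS](reindex_inj (@perm_inj _ s)).
  rewrite (bigID (fun k : 'I_n => (k < f)%N)) /= big_ord_narrow /=.
  have -> : \sum_(i < f) G (s (widen_ord fn i)) j' = 1.
    rewrite (bigD1 j') //= big1 => [|k kj]; rewrite (sg _ (widen_ord fn _) erefl) Gg.
      by rewrite eqxx addr0.
    by rewrite (negPf kj).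
  have -> : \sum_(i < n | ~~ (i < f)%N) G (s i) j' = (\sum_(i < n | (f <= i)%N) A i j)%:~R.
    rewrite raddf_sum /=; apply: eq_big => [i|i]; first by rewrite -leqNgt.
    by rewrite -leqNgt => fi; rewrite (AGr _ _ j').
  rewrite card_ones => [|i fi]; last exact: A01.
  by rewrite natz -pmulrn natrF2; case: odd => //.
have wA : wirth_f A f.
  split; last by do !split.
  (* For [f = n] the first column would have an odd number of 1's among no rows. *)
  have [//|nf] := ltnP f n.
  have f0 : (0 < f)%N by apply: leq_trans nf.
  have := Aodd (Ordinal n0) f0.
  rewrite (_ : [set _ | _] = set0) ?cards0 //; apply/setP=> i; rewrite !inE.
  by rewrite leqNgt (leq_trans (ltn_ord i) nf).
have [uA rA] := wirth_reflexive_witness wA.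
have rV' := reflexive_witness_perm s^-1 rV.
(* It remains that each code lies in the other: [A] kills the permuted [W] mod 2, and the permuted
   [V] kills [wirth_half A f] mod 2. *)
have [||N uN eN] := same_code_unit_mul rA rV'.
- rewrite invgK modF2M /modF2 map_perm_mx -row_permE; apply/matrixP=> k l; rewrite !mxE.
  under eq_bigr do rewrite !mxE -/(Wb _ _).
  have [kf|fk] := ltnP k f.
    apply: big1 => j _; case: ifP => _; rewrite ?mul0r //.
    by rewrite (_ : 2%:~R = 0) ?mul0r //; apply/eqP; rewrite intrF2_eq0.
  have c1 (j : 'I_n) : (f <= j)%N -> (A k j)%:~R = (k == j)%:R :> 'F_2.
    by move=> fj; rewrite A1 //; case: eqP.
  have := sum_unit_tail (fun j => Wb (s j) l) fk c1.
  under [LHS]eq_bigr do rewrite !mxE ltnNge fk /=.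
  move=> ->; rewrite big_ord_narrow /= (_ : Wb (s k) l = (G *m T) (s k) l); last by rewrite -WG.
  rewrite [X in _ + X]mxE -big_split /= big1 // => i _.
  by rewrite (AGr _ _ i) // !mxE (sg i (widen_ord fn i)) // addrr_pchar2.
(* Mod 2, [wirth_half A f] is [G] with rows permuted by [s], padded by zero columns through [E]; and
   [V] kills [G = Wb *m S]. *)
- pose E : 'M['F_2]_(f, n) := \matrix_(i, j) (i == j :> nat)%:R.
  have -> : modF2 (wirth_half A f) = perm_mx s *m (G *m E).
    rewrite -row_permE; apply/matrixP=> k j.
    rewrite [LHS]mxE [wirth_half _ _ _ _]mxE [RHS]mxE [RHS]mxE.
    have Eij i : E i j = (i == j :> nat)%:R by rewrite mxE.
    have [jf|fj] := ltnP j f.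
      rewrite (bigD1 (Ordinal jf)) //= big1 ?addr0 => [|i ij].
        rewrite Eij eqxx mulr1; have [kf|fk] := ltnP k f.
          rewrite (sg (Ordinal kf)) // Gg (_ : (Ordinal kf == _) = (k == j)); last by [].
          by case: eqP.
        by rewrite rmorphN /= (AGr _ _ (Ordinal jf)) // oppr_pchar2.
      by rewrite Eij (_ : (i == j :> nat) = false) ?mulr0 //; apply/negbTE.
    rewrite [RHS]big1 => [|i _].
      case: ltnP => kf; last by apply/eqP; rewrite intrF2_eq0; exact: dvdz_mulr.
      by case: eqP => // kj; move: kf; rewrite kj ltnNge fj.
    rewrite Eij (_ : (i == j :> nat) = false) ?mulr0 //; apply/negbTE.
    by rewrite neq_ltn (leq_trans (ltn_ord i) fj).
  rewrite modF2M /modF2 map_perm_mx -!mulmxA (mulmxA (perm_mx _) (perm_mx _)) -perm_mxM mulVg.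
  by rewrite perm_mx1 mul1mx /G !mulmxA -[map_mx _ _]/(modF2 V) -modF2M VW modF2_scalar2 !mul0mx.
by exists N, A, (s^-1)%g; split=> //; exists f.
Qed.

(** * Zero coordinates and the reduction *)

(** Recursive, so as to follow the constructors of [splits_segs]. It gives the code [r] further
    coordinates at which all words vanish. *)
Fixpoint unit_ext r n (Y : 'M[int]_n) : 'M[int]_(r + n) :=
  if r is r'.+1 then block_mx (1%:M : 'M_1) 0 0 (unit_ext r' Y) else Y.

Lemma unit_extE r n (Y : 'M[int]_n) : unit_ext r Y = block_mx 1%:M 0 0 Y.
Proof.
elim: r => [|r IH] /=.
  by apply/matrixP=> i j; case: (split_ordP i) => [[]|k] // ->;
    case: (split_ordP j) => [[]|l] // ->; rewrite block_mxEdr;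
    congr (Y _ _); apply: val_inj.
rewrite IH -[X in block_mx _ X _ _]row_mx0 -[X in block_mx _ _ X _]col_mx0.
rewrite block_mxA castmx_id row_mx0 col_mx0; congr block_mx.
exact: esym (scalar_mx_block 1 r 1).
Qed.

Lemma reflexive_unit_ext r n (Y : 'M[int]_n) :
  reflexive_mx (unit_ext r Y) <-> reflexive_mx Y.
Proof. by elim: r => [//|r IH] /=; rewrite reflexive_block1. Qed.

Lemma kernel_block1 n (X : 'M[int]_n) (x : 'cV['F_2]_(1 + n)) :
  modF2 (block_mx (1%:M : 'M_1) 0 0 X) *m x = 0 -> x (0 : 'I_n.+1) 0 = 0.
Proof.
rewrite /modF2 map_block_mx map_mx1 !map_mx0 -(vsubmxK x) mul_block_col mul1mx mul0mx addr0.
rewrite -(@col_mx0 _ 1 n) => /eq_col_mx [x0 _].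
have -> : (0 : 'I_n.+1) = lshift n (0 : 'I_1) by apply: val_inj.
by rewrite col_mxEu x0 mxE.
Qed.

Lemma perm_fix0_lift n (s : {perm 'I_n.+1}) : s 0 = 0 ->
  exists s' : {perm 'I_n}, s = lift0_perm s'.
Proof.
move=> s0.
have nz j : 0 != s (lift 0 j) by rewrite -{1}s0 (inj_eq perm_inj) neq_lift.
pose g j := odflt j (unlift 0 (s (lift 0 j))).
have gE j : s (lift 0 j) = lift 0 (g j).
  by rewrite /g; case: (unlift_some (nz j)) => k -> ->.
have ig : injective g.
  by move=> j k e; apply: (@lift_inj _ 0); apply: (@perm_inj _ s); rewrite !gE e.
exists (perm ig); apply/permP => k; case: (unliftP 0 k) => [j|] ->.
  by rewrite lift0_perm_lift permE gE.
by rewrite lift0_perm0.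
Qed.

Lemma kernel_unit_mul n p (U : 'M[int]_n) (X : 'M[int]_(n, p)) (x : 'cV_p) :
  U \in unitmx -> modF2 (U *m X) *m x = 0 <-> modF2 X *m x = 0.
Proof.
move=> uU; split=> [|h]; last by rewrite modF2M -mulmxA h mulmx0.
move/(congr1 (mulmx (modF2 (invmx U)))); rewrite mulmxA -modF2M mulmxA mulVmx // mul1mx.
by rewrite mulmx0.
Qed.

(* Both codes vanish at coordinate 0, so composing the coordinate permutation with the
   transposition [(0 (s 0))] changes nothing and makes it fix 0. *)
Lemma mx_equiv_block1_cancel n (X1 X2 : 'M[int]_n) :
  reflexive_mx X1 -> reflexive_mx X2 ->
  mx_equiv (block_mx (1%:M : 'M_1) 0 0 X1) (block_mx (1%:M : 'M_1) 0 0 X2) ->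
  mx_equiv X1 X2.
Proof.
move=> r1 r2 [U [s [uU eE]]].
have rE1 := (reflexive_block1 X1).2 r1; have rE2 := (reflexive_block1 X2).2 r2.
set E1 := block_mx 1%:M 0 0 X1 in eE rE1; set E2 := block_mx 1%:M 0 0 X2 in eE rE2.
have k12 (x : 'cV_(1 + n)) : modF2 E2 *m x = 0 <-> modF2 E1 *m (perm_mx s *m x) = 0.
  rewrite eE -mulmxA kernel_unit_mul // modF2M -mulmxA.
  by rewrite [in modF2 (perm_mx s)]/modF2 map_perm_mx.
pose s0 : 'I_n.+1 := s (0 : 'I_n.+1).
pose t : {perm 'I_(1 + n)} := tperm (0 : 'I_n.+1) s0.
have permc (q : {perm 'I_(1 + n)}) (x : 'cV['F_2]_(1 + n)) k :
    (perm_mx q *m x) k 0 = x (q k) 0 by rewrite -row_permE mxE.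
have fixt (x : 'cV_(1 + n)) : modF2 E2 *m x = 0 -> perm_mx t *m x = x.
  move=> kx; have x0 := kernel_block1 kx.
  have /k12 /kernel_block1 := kx; rewrite permc -/s0 => xs.
  by apply/colP=> k; rewrite permc; case: tpermP => [->|->|//]; rewrite x0 xs.
pose s' := (s * t)%g.
have ps' (x : 'cV['F_2]_(1 + n)) : perm_mx s' *m x = perm_mx s *m (perm_mx t *m x).
  by rewrite perm_mxM mulmxA.
have [||x|N uN eN] := @same_kernel_unit_mul _ (E1 *m perm_mx s') E2 => //.
- exact: reflexive_perm.
- rewrite modF2M -mulmxA [in modF2 (perm_mx _)]/modF2 map_perm_mx ps' -k12; split=> h.
    move/fixt: (h); rewrite mulmxA -perm_mxM tperm2 perm_mx1 mul1mx => e.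
    by rewrite e.
  by rewrite fixt.
have [s'' es''] : exists s'' : {perm 'I_n}, s' = lift0_perm s''.
  by apply: perm_fix0_lift; rewrite permM tpermR.
move: eN uN; rewrite es'' -lift0_mx_perm /lift0_mx mulmx_block.
rewrite !mulmx0 !mul0mx mulmx1 !addr0 !add0r /E2 -(submxK N) mulmx_block.
rewrite !mulmx0 !mulmx1 !addr0 !add0r => /eq_block_mx [e11 _ e21 e22].
(* The lower left block of [N] vanishes, so the determinant factors and the lower right block is
   unimodular too. *)
rewrite -e21 unitmxE det_ublock unitrM => /andP[_ u22].
by exists (drsubmx N), s''; rewrite unitmxE u22 e22 mulmxA.
Qed.

(** Rows before [f] have entries 0 and 2 only, and every later row has a diagonal 1; hence a lone 1
    is diagonal and the part of its row in [C] is zero. *)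
Lemma wirth_single n (A : 'M[int]_n) f (i : 'I_n) : wirth_f A f -> single_one A i ->
  (f <= i)%N /\ forall j, A i j = (i == j)%:R.
Proof.
move=> [_ [A2 [A1 [A01 _]]]] /cards1P [k ek].
have fi : (f <= i)%N.
  rewrite leqNgt; apply/negP => fi; have : k \in [set j | A i j == 1] by rewrite ek set11.
  by rewrite inE A2 //; case: ifP.
split=> // j; have [fj|jf] := leqP f j; first exact: A1.
have ki : i = k by apply/set1P; rewrite -ek inE A1 // eqxx.
have ij : (i == j) = false by apply/eqP => ij; move: jf; rewrite -ij ltnNge fi.
rewrite ij; case: (A01 i j fi jf) => // e.
have : j \in [set k] by rewrite -ek inE e.
by rewrite inE -ki eq_sym ij.
Qed.

Lemma wirth_not_single n (A : 'M[int]_n) f (i : 'I_n) : wirth_f A f -> (f <= i)%N ->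
  ~~ single_one A i -> exists2 j : 'I_n, (j < f)%N & A i j = 1.
Proof.
move=> [_ [_ [A1 [A01 _]]]] fi ns.
case: (pickP (fun j : 'I_n => (j < f)%N && (A i j == 1))) => [j /andP[jf /eqP e]|h].
  by exists j.
case/negP: ns; rewrite /single_one (_ : [set j | _] = [set i]) ?cards1 //.
apply/setP=> j; rewrite !inE; have [fj|jf] := leqP f j.
  by rewrite A1 // (eq_sym j); case: (i == j).
move: (h j); rewrite jf /= => ->; apply/esym/eqP => ji.
by move: jf; rewrite ji ltnNge fi.
Qed.

Lemma wirth_single_lt n (A : 'M[int]_n) f (i : 'I_n) : wirth_f A f -> (i < f)%N -> ~~ single_one A i.
Proof. by move=> wA; rewrite ltnNge; apply: contra => /(wirth_single wA) []. Qed.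

Lemma wirth_single_one n (A : 'M[int]_n) f (i j : 'I_n) : wirth_f A f ->
  (f <= i)%N -> (j < f)%N -> A i j = 1 -> ~~ single_one A i.
Proof.
move=> wA fi jf e; apply/negP => /(wirth_single wA) [_ h]; move: (h j); rewrite e.
by case: eqP => // ij; move: jf; rewrite -ij ltnNge fi.
Qed.

(** [phi] lists the indices of rows with a single 1 first. Their rows are unit rows, and so are
    their columns outside these rows zero, since the indices are at least [f]. The same [phi] acts
    on rows and columns, so it is a change of basis and a reordering of vertices. *)
Lemma wirth_reorder n (A : 'M[int]_n) : wirth A ->
  exists2 phi : 'I_(num_single A + #|kept A|) -> 'I_n, bijective phi &
    unit_ext (num_single A) (reduction A) = \matrix_(i, j) A (phi i) (phi j).
Proof.
move=> [f wA]; case: (wA) => [_ [A2 [A1 _]]].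
pose S := [set i | single_one A i].
pose phi (k : 'I_(#|S| + #|kept A|)) : 'I_n :=
  match split k with inl a => enum_val a | inr b => enum_val b end.
have phil a : phi (lshift _ a) = enum_val a by rewrite /phi -[lshift _ _]/(unsplit (inl _)) unsplitK.
have phir a : phi (rshift _ a) = enum_val a by rewrite /phi -[rshift _ _]/(unsplit (inr _)) unsplitK.
have sS (a : 'I_#|S|) : single_one A (enum_val a) by have := enum_valP a; rewrite inE.
have sK (a : 'I_#|kept A|) : ~~ single_one A (enum_val a) by have := enum_valP a; rewrite inE.
exists phi.
  apply: inj_card_bij => [i j|].
    case: (split_ordP i) => a ->; case: (split_ordP j) => b ->; rewrite ?phil ?phir.
    - by move/enum_val_inj ->.
    - by move=> e; have := sS a; rewrite e (negPf (sK b)).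
    - by move=> e; have := sS b; rewrite -e (negPf (sK a)).
    - by move/enum_val_inj ->.
  rewrite !card_ord -{1}(card_ord n) -(cardsC S) (_ : ~: S = kept A) //.
  by apply/setP=> i; rewrite !inE.
rewrite unit_extE; apply/matrixP=> i j.
case: (split_ordP i) => a ->; case: (split_ordP j) => b ->;
  rewrite [RHS]mxE ?block_mxEul ?block_mxEur ?block_mxEdl ?block_mxEdr ?phil ?phir ?phil mxE.
all: try by [].
- by have [_ ->] := wirth_single wA (sS a); rewrite (inj_eq enum_val_inj).
- have [_ ->] := wirth_single wA (sS a); case: eqP => // e.
  by have := sS a; rewrite e (negPf (sK b)).
- have [fb _] := wirth_single wA (sS b).
  have ne : enum_val a == enum_val b = false.
    by apply/eqP => e; have := sS b; rewrite -e (negPf (sK a)).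
  by have [fa|af] := leqP f (enum_val a); [rewrite A1 // ne | rewrite A2 // ne].
Qed.

Lemma reflexive_reindex m n (A : 'M[int]_n) (phi : 'I_m -> 'I_n) : bijective phi ->
  reflexive_mx A -> reflexive_mx (\matrix_(i, j) A (phi i) (phi j)).
Proof.
move=> bphi [W [u [WA AW uA]]].
have sum_phi (F : 'I_n -> int) : \sum_k F (phi k) = \sum_k F k.
  by rewrite [RHS](reindex phi) //; exact: onW_bij.
exists (\matrix_(i, j) W (phi i) (phi j)), (\row_j u 0 (phi j)).
have aux (X Y : 'M[int]_n) : X *m Y = 2%:M ->
    (\matrix_(i, j) X (phi i) (phi j)) *m (\matrix_(i, j) Y (phi i) (phi j)) = 2%:M.
  move=> e; apply/matrixP=> i j; move/matrixP/(_ (phi i) (phi j)): e; rewrite !mxE.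
  rewrite (inj_eq (bij_inj bphi)) => <-; rewrite -[RHS]sum_phi.
  by apply: eq_bigr => k _; rewrite !mxE.
split; [exact: aux | exact: aux | apply/rowP=> j].
move/rowP/(_ (phi j)): uA; rewrite !mxE -sum_phi => <-.
by apply: eq_bigr => k _; rewrite !mxE.
Qed.

Lemma reflexive_reduction n (A : 'M[int]_n) : wirth A -> reflexive_mx (reduction A).
Proof.
move=> wA; have [phi bphi e] := wirth_reorder wA.
apply/(reflexive_unit_ext (num_single A)); rewrite e.
exact: reflexive_reindex (wirth_reflexive wA).
Qed.

(** The enumeration of [S] is increasing and thus starts with [0, ..., f-1]; so deleting indices
    from [f] on leaves the block boundary at [f]. *)
Lemma enum_val_initial n f (S : {set 'I_n}) (i : 'I_#|S|) : (f <= n)%N ->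
  (forall k : 'I_n, (k < f)%N -> k \in S) -> (enum_val i < f)%N = (i < f)%N.
Proof.
move=> fn fS; pose p x := if insub x is Some k then k \in S else false.
have eS : map val (enum S) = iota 0 f ++ filter p (iota f (n - f)).
  have -> : enum S = filter (mem S) (enum 'I_n) by rewrite enumT.
  rewrite (@eq_filter _ _ (preim val p)) => [|k]; last by rewrite /= /p valK.
  rewrite -filter_map val_enum_ord -{1}(subnKC fn) iotaD filter_cat add0n.
  congr (_ ++ _); apply/all_filterP/allP => k; rewrite mem_iota /= add0n => kf.
  by rewrite /p; case: insubP => [k' _ ek|]; rewrite ?(leq_trans kf fn) // fS // ek.
have i_lt : (i < size (enum S))%N by rewrite -cardE.
have -> : enum_val i = nth 0%N (map val (enum S)) i :> nat.
  by rewrite (nth_map (enum_val i)) // -(enum_val_nth).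
rewrite eS nth_cat size_iota; have [lt_if|fi] := ltnP i f; first by rewrite nth_iota // add0n.
apply/negbTE; rewrite -leqNgt.
have : nth 0%N (filter p (iota f (n - f))) (i - f) \in filter p (iota f (n - f)).
  by apply: mem_nth; rewrite ltn_subLR //; move: i_lt; rewrite -(size_map val) eS size_cat size_iota.
by rewrite mem_filter mem_iota => /andP[_ /andP[]].
Qed.

(** A deleted row is zero in the first [f] columns, so the column parities survive. Positivity
    excludes the identity matrix, whose reduction is empty and admits no [f < 0]. *)
Lemma reduction_1min n (A : 'M[int]_n) : wirth A -> (0 < #|kept A|)%N ->
  wirth_1min (reduction A).
Proof.
move=> [f wA] k0; case: (wA) => [fn [A2 [A1 [A01 Aodd]]]].
have keptP i : (i \in kept A) = ~~ single_one A i by rewrite inE.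
have ltf (i : 'I_#|kept A|) : (enum_val i < f)%N = (i < f)%N.
  apply: enum_val_initial (ltnW fn) _ => k kf.
  by rewrite keptP (wirth_single_lt wA).
have lef (i : 'I_#|kept A|) : (f <= enum_val i)%N = (f <= i)%N by rewrite leqNgt ltf -leqNgt.
have rE i j : reduction A i j = A (enum_val i) (enum_val j) by rewrite mxE.
have lift_kept (j : 'I_n) (kj : j \in kept A) : {i : 'I_#|kept A| | enum_val i = j}.
  by exists (enum_rank_in kj j); rewrite enum_rankK_in.
have row1 (i : 'I_#|kept A|) : (f <= i)%N ->
    exists j : 'I_#|kept A|, (j < f)%N /\ reduction A i j = 1.
  rewrite -lef => fi; have := enum_valP i; rewrite keptP => /(wirth_not_single wA fi) [j jf e].
  have kj : j \in kept A by rewrite keptP (wirth_single_lt wA).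
  have [j' ej'] := lift_kept j kj; exists j'; by rewrite -ltf rE ej' jf.
have odd_red (j : 'I_#|kept A|) : (j < f)%N ->
    odd #|[set i : 'I_#|kept A| | (f <= i)%N && (reduction A i j == 1)]|.
  rewrite -ltf => jf; have := Aodd _ jf; congr odd.
  rewrite -(card_imset _ (@enum_val_inj _ (mem (kept A)))); congr #|pred_of_set _|.
  apply/setP => i; rewrite inE; apply/andP/imsetP => [[fi /eqP e]|[i' + ->]].
    have ki : i \in kept A by rewrite keptP (wirth_single_one wA fi jf e).
    have [i' ei'] := lift_kept i ki; exists i' => //.
    by rewrite inE -lef rE ei' fi e eqxx.
  by rewrite inE -lef rE => /andP.
have fk : (f < #|kept A|)%N.
  rewrite ltnNge; apply/negP => kf.
  have := odd_red (Ordinal k0) (leq_trans k0 kf).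
  rewrite (_ : [set _ | _] = set0) ?cards0 //; apply/setP=> i; rewrite !inE.
  by rewrite leqNgt (leq_trans (ltn_ord i) kf).
exists f; split=> //; split=> //; split; last split; last split=> //.
- by move=> i j; rewrite -ltf rE => fi; rewrite A2 // (inj_eq enum_val_inj).
- by move=> i j; rewrite -!lef rE => fi fj; rewrite A1 // (inj_eq enum_val_inj).
- by move=> i j; rewrite -lef -ltf rE => fi fj; apply: A01.
Qed.

Lemma wirth_1min_single n (A : 'M[int]_n) : wirth A -> wirth_1min A <-> num_single A = 0%N.
Proof.
move=> [f wA]; split=> [[f' [wA' h]]|/eqP].
  apply/eqP; rewrite cards_eq0; apply/eqP/setP=> i; rewrite !inE.
  have [fi|fi] := leqP f' i; last by apply/negbTE/(wirth_single_lt wA').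
  by have [j [jf e]] := h i fi; apply/negbTE/(wirth_single_one wA' fi jf e).
rewrite cards_eq0 => /eqP /setP s0; exists f; split=> // i fi.
have := s0 i; rewrite !inE => /negbT /(wirth_not_single wA fi) [j jf e].
by exists j.
Qed.

(* Every coordinate is met by some codeword of a 1-minimal Wirth matrix. *)
Lemma wirth_1min_no_unit_row n (A : 'M[int]_n) (l : 'rV[int]_n) (j : 'I_n) :
  wirth_1min A -> (forall k, k != j -> (l *m A) 0 k = 0) -> ~~ odd `|(l *m A) 0 j|.
Proof.
move=> [f [wA h]] l0.
(* [l A] is a multiple of the [j]-th unit row; times [2 A^-1] it becomes that multiple of row [j] of
   [wirth_half], with even entries. As this row contains 1 or -1, the multiple is even. *)
have e k : (l *m A) 0 j * wirth_half A f j k = 2 * l 0 k.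
  have : (l *m A *m wirth_half A f) 0 k = 2 * l 0 k.
    by rewrite -mulmxA wirth_halfP // mul_mx_scalar mxE.
  by rewrite mxE (bigD1 j) //= big1 ?addr0 // => i ij; rewrite l0 // mul0r.
have [fj|jf] := leqP f j.
  have [k [kf ek]] := h j fj; have := e k; rewrite [wirth_half _ _ _ _]mxE ltnNge fj /= kf ek; lia.
have := e j; rewrite [wirth_half _ _ _ _]mxE jf eqxx; lia.
Qed.

(** * Convex hulls *)

Section ConvexHulls.
Variable R : realType.
Implicit Types (n m : nat).

Lemma toRM m n p (A : 'M[int]_(m, n)) (B : 'M[int]_(n, p)) :
  toR R (A *m B) = toR R A *m toR R B.
Proof. exact: (map_mxM (intr : {rmorphism int -> R})). Qed.

Lemma toR1 n : toR R 1%:M = 1%:M :> 'M_n.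
Proof. exact: (map_mx1 (intr : {rmorphism int -> R})). Qed.

Lemma toR_inj m n : injective (@toR R m n).
Proof.
move=> A B /matrixP e; apply/matrixP=> i j; move: (e i j); rewrite !mxE.
exact: intr_inj.
Qed.

Lemma toR_unit n (X : 'M[int]_n) : \det X != 0 -> toR R X \in unitmx.
Proof.
move=> dX; rewrite unitmxE unitfE.
by rewrite (_ : \det (toR R X) = (\det X)%:~R) ?intr_eq0 // -det_map_mx.
Qed.

Lemma toR_sign m n (b : bool) (A : 'M[int]_(m, n)) : toR R ((-1) ^+ b *: A) = (-1) ^+ b *: toR R A.
Proof. by apply/matrixP=> i j; rewrite !mxE rmorphM /= rmorph_sign. Qed.

Lemma toR_colE n (X : 'M[int]_n) j : toR R (col j X) = toR R X *m delta_mx j 0.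
Proof. by rewrite -colE; apply/matrixP=> i k; rewrite !mxE. Qed.

Lemma mulmx_colE n (X : 'M[R]_n) (t : 'cV[R]_n) : X *m t = \sum_j t j 0 *: col j X.
Proof.
apply/colP=> i; rewrite summxE !mxE; apply: eq_bigr => j _.
by rewrite !mxE mulrC.
Qed.

Lemma conv_fin n (S : 'cV[R]_n -> Prop) (I : finType) (p : I -> 'cV[R]_n) (w : I -> R) :
  (forall i, S (p i)) -> (forall i, 0 <= w i) -> \sum_i w i = 1 ->
  conv_set S (\sum_i w i *: p i).
Proof.
move=> Sp w0 w1; exists #|I|, (p \o enum_val), (w \o enum_val); split=> [i|] /=.
  exact: Sp.
split=> [i|]; first exact: w0.
by rewrite -w1 -(big_enum_val w) -(big_enum_val (fun i => w i *: p i)).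
Qed.

Lemma conv_gen n (S : 'cV[R]_n -> Prop) x : S x -> conv_set S x.
Proof.
move=> Sx; have := @conv_fin _ S unit (fun=> x) (fun=> 1) (fun=> Sx) (fun=> ler01).
by rewrite !big_const card_unit /= !addr0 scale1r; apply.
Qed.

Lemma conv_two n (S : 'cV[R]_n -> Prop) x y (t : R) : S x -> S y -> 0 <= t <= 1 ->
  conv_set S (t *: x + (1 - t) *: y).
Proof.
move=> Sx Sy /andP[t0 t1].
have := @conv_fin _ S bool (fun b => if b then x else y) (fun b => if b then t else 1 - t).
rewrite !big_bool /=; apply; [by case | | lra].
by case=> //; lra.
Qed.

Definition convex n (C : 'cV[R]_n -> Prop) := forall x y (t : R),
  C x -> C y -> 0 <= t <= 1 -> C (t *: x + (1 - t) *: y).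

Lemma conv_convex n (S : 'cV[R]_n -> Prop) : convex (conv_set S).
Proof.
move=> _ _ t [k [p [w [Sp [w0 [w1 ->]]]]]] [l [q [v [Sq [v0 [v1 ->]]]]]] /andP[t0 t1].
have := @conv_fin _ S ('I_k + 'I_l)%type
  (fun i => match i with inl a => p a | inr b => q b end)
  (fun i => match i with inl a => t * w a | inr b => (1 - t) * v b end).
rewrite !big_sumType /= -!mulr_sumr w1 v1 !scaler_sumr.
under [X in conv_set _ (X + _)]eq_bigr do rewrite -scalerA.
under [X in conv_set _ (_ + X)]eq_bigr do rewrite -scalerA.
apply; [by case | | lra].
by case=> a; apply: mulr_ge0 => //; lra.
Qed.

Lemma conv_min n (S C : 'cV[R]_n -> Prop) x : convex C -> (forall y, S y -> C y) ->
  conv_set S x -> C x.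
Proof.
move=> cC SC [k [p [w [Sp [w0 [w1 ->]]]]]] {x}.
have {SC}Cp i : C (p i) by apply: SC.
elim: k p w w0 w1 Cp {Sp} => [|k IH] p w w0 w1 Cp.
  by move: w1; rewrite big_ord0 => /eqP; rewrite eq_sym oner_eq0.
move: w1; rewrite !big_ord_recl /= => w1.
set w' := fun i => w (lift ord0 i) / (1 - w ord0).
have s0 : 0 <= \sum_(i < k) w (lift ord0 i) by apply: sumr_ge0.
(* If the first weight is 1, the others vanish and cannot be rescaled to sum 1. *)
have [e|ne] := eqVneq (w ord0) 1.
  have z : \sum_(i < k) w (lift ord0 i) = 0 by lra.
  rewrite e scale1r big1 ?addr0 // => i _.
  by rewrite (psumr_eq0P _ z) ?scale0r.
have w0l : w ord0 <= 1 by lra.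
have d0 : 1 - w ord0 != 0 by rewrite subr_eq0 eq_sym.
have -> : \sum_(i < k) w (lift ord0 i) *: p (lift ord0 i) =
    (1 - w ord0) *: \sum_(i < k) w' i *: p (lift ord0 i).
  rewrite scaler_sumr; apply: eq_bigr => i _; rewrite scalerA /w'; congr (_ *: _).
  by field.
apply: cC => //; last by rewrite w0.
apply: IH => [i||//]; first by apply: divr_ge0 => //; lra.
by rewrite -mulr_suml -w1 addrAC subrr add0r mulfV // -[X in X != 0](addKr (w ord0)) w1 addrC.
Qed.

Lemma conv_mono n (S S' : 'cV[R]_n -> Prop) x : (forall y, S y -> S' y) ->
  conv_set S x -> conv_set S' x.
Proof. by move=> SS; apply: conv_min; [exact: conv_convex | move=> y /SS /conv_gen]. Qed.

Lemma vertex_conv n (S : 'cV[R]_n -> Prop) x : vertex (conv_set S) x -> S x.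
Proof.
(* The strengthened predicate is convex: a proper combination equal to the vertex [x] has both ends
   equal to [x]. *)
move=> [Px vx]; suff [_ h] : conv_set S x /\ (x = x -> S x) by exact: h.
apply: (@conv_min _ S (fun y => conv_set S y /\ (y = x -> S x))) Px => [a b t|y Sy]; last first.
  by split=> [|<-//]; apply: conv_gen.
move=> [Pa Sa] [Pb Sb] /andP[t0 t1]; split; first by apply: conv_convex; rewrite ?t0.
have [->|nt0] := eqVneq t 0; first by rewrite scale0r add0r subr0 scale1r.
have [->|nt1] := eqVneq t 1; first by rewrite subrr scale0r addr0 scale1r.
have t01 : 0 < t < 1 by rewrite !lt_neqAle nt1 t1 t0 eq_sym nt0.
move=> e; have ab := vx a b t Pa Pb t01 (esym e); apply: Sb.
by rewrite -e ab -scalerDl addrC subrK scale1r.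
Qed.

Lemma vertex_same n (P Q : 'cV[R]_n -> Prop) x : same P Q -> vertex P x <-> vertex Q x.
Proof.
move=> e; split=> - [Px v]; split; try exact/e.
  by move=> y z t /e Py /e Pz; apply: v.
by move=> y z t /e Py /e Pz; apply: v.
Qed.

Lemma convex_comb_extreme (t a b s : R) : 0 < t < 1 -> `|a| <= 1 -> `|b| <= 1 -> `|s| = 1 ->
  s = t * a + (1 - t) * b -> a = s /\ b = s.
Proof.
move=> /andP[t0 t1]; rewrite !ler_norml => /andP[a0 a1] /andP[b0 b1] s1 e.
move: s1; case: (ger0P s) => s0 s1.
  by have [-> ->] : a = 1 /\ b = 1; [split; nra | lra].
by have [-> ->] : a = -1 /\ b = -1; [split; nra | lra].
Qed.

Definition l1 n (x : 'cV[R]_n) : R := \sum_i `|x i 0|.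

Lemma l1_convex n (Y : 'M[R]_n) : convex (fun x => l1 (Y *m x) <= 1).
Proof.
move=> x y t x1 y1 /andP[t0 t1].
rewrite mulmxDr -!scalemxAr.
have : l1 (t *: (Y *m x) + (1 - t) *: (Y *m y)) <= t * l1 (Y *m x) + (1 - t) * l1 (Y *m y).
  rewrite /l1 !mulr_sumr -big_split /=; apply: ler_sum => i _; rewrite !mxE.
  by apply: le_trans (ler_normD _ _) _; rewrite !normrM (ger0_norm t0) (@ger0_norm _ (1 - t)) ?subr_ge0.
move/le_trans; apply; nra.
Qed.

Lemma l1_delta n (j : 'I_n) : l1 (delta_mx j 0) = 1.
Proof.
rewrite /l1 (bigD1 j) //= big1 ?addr0 => [|i ij]; first by rewrite mxE !eqxx normr1.
by rewrite mxE (negPf ij) normr0.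
Qed.

Lemma mem_points n (X : 'M[int]_n) y :
  y \in (0 :: [seq toR R (col j X) | j <- enum 'I_n]
           ++ [seq - toR R (col j X) | j <- enum 'I_n]) <->
  y = 0 \/ exists j (b : bool), y = (-1) ^+ b *: toR R (col j X).
Proof.
rewrite inE mem_cat; split=> [/orP[/eqP->|/orP[]]|[->|[j [b ->]]]].
- by left.
- by case/mapP=> j _ ->; right; exists j, false; rewrite scale1r.
- by case/mapP=> j _ ->; right; exists j, true; rewrite scaleN1r.
- by rewrite eqxx.
- case: b; rewrite ?scaleN1r ?scale1r; apply/orP; right; apply/orP; [right | left];
  exact/map_f/mem_enum.
Qed.

(** In coordinates [t] with respect to the columns, the crosspolytope is the unit ball of the l1
    norm. The weight [|t_j|] goes to the [j]-th column with the sign of [t_j], and the slack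
    [1 - l1 t] to the listed point 0. *)
Lemma Pmx_l1 n (X : 'M[int]_n) x : \det X != 0 ->
  Pmx R X x <-> l1 (invmx (toR R X) *m x) <= 1.
Proof.
move=> /toR_unit uX; split.
  apply: conv_min (@l1_convex _ _) _ => y /mem_points [->|[j [b ->]]].
    by rewrite mulmx0 /l1 big1 // => i _; rewrite mxE normr0.
  rewrite -scalemxAr toR_colE mulmxA mulVmx // mul1mx.
  rewrite -[leRHS](l1_delta j) /l1; apply: ler_sum => i _; rewrite mxE normrM.
  by rewrite normrX normrN1 expr1n mul1r.
set t := invmx _ *m x => t1.
pose p (o : 'I_1 + 'I_n) := if o is inr j then (-1) ^+ (t j 0 < 0)%R *: toR R (col j X) else 0.
pose w (o : 'I_1 + 'I_n) := if o is inr j then `|t j 0| else 1 - l1 t.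
have -> : x = \sum_o w o *: p o.
  rewrite big_sumType big_ord1 /= scaler0 add0r -[LHS]mul1mx -(mulmxV uX) -mulmxA -/t mulmx_colE.
  apply: eq_bigr => j _; rewrite scalerA mulrC -numEsign; congr (_ *: _).
  by apply/colP=> i; rewrite !mxE.
apply: conv_fin => [[_|j]|[_|j]|] /=.
- by apply/mem_points; left.
- by apply/mem_points; right; exists j, (t j 0 < 0)%R.
- by rewrite subr_ge0.
- exact: normr_ge0.
- by rewrite big_sumType big_ord1 /= subrK.
Qed.
End ConvexHulls.

(** * Isomorphisms of crosspolytopes *)

Section CrossPolytopes.
Variable R : realType.
Implicit Types (n m : nat).

Lemma col_scale_inj n (X : 'M[int]_n) j k (c : R) : \det X != 0 ->
  toR R (col j X) = c *: toR R (col k X) -> j = k.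
Proof.
move=> /(toR_unit R) uX; rewrite !toR_colE => /(congr1 (mulmx (invmx (toR R X)))).
rewrite -scalemxAr !mulmxA mulVmx // !mul1mx => /matrixP /(_ j 0).
rewrite !mxE !eqxx andbT; case: eqP => // _ /eqP; rewrite mulr0 oner_eq0 //.
Qed.

Lemma toR_col_neq0 n (X : 'M[int]_n) j : \det X != 0 -> toR R (col j X) != 0.
Proof.
move=> /(toR_unit R) uX; apply/eqP; rewrite toR_colE => /(congr1 (mulmx (invmx (toR R X)))).
rewrite mulmxA mulVmx // mul1mx mulmx0 => /matrixP /(_ j 0) /eqP.
by rewrite !mxE !eqxx oner_eq0.
Qed.

Lemma scale_sign_eq0 n (b : bool) (x : 'cV[R]_n) : ((-1) ^+ b *: x == 0) = (x == 0).
Proof. by rewrite scaler_eq0 signr_eq0. Qed.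

Lemma Pmx_col n (X : 'M[int]_n) j (b : bool) : Pmx R X ((-1) ^+ b *: toR R (col j X)).
Proof. by apply: conv_gen; apply/mem_points; right; exists j, b. Qed.

(** A coordinate 1 or -1 is extreme, hence shared by both ends of a combination, and it exhausts the
    l1 norm, so the other coordinates vanish. The point 0 is the midpoint of opposite columns unless
    there are none. *)
Lemma vertex_Pmx n (X : 'M[int]_n) x : \det X != 0 ->
  vertex (Pmx R X) x <-> n = 0%N \/ exists j (b : bool), x = (-1) ^+ b *: toR R (col j X).
Proof.
move=> dX; have uX := toR_unit R dX; split=> [vx|[n0|[j [b ->]]]].
- have /mem_points [x0|] := vertex_conv vx; last by right.
  case: (posnP n) => [|n0]; first by left.
  have j : 'I_n := Ordinal n0.
  have := vx.2 ((-1) ^+ false *: toR R (col j X)) ((-1) ^+ true *: toR R (col j X)) (2^-1)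
    (Pmx_col _ _ _) (Pmx_col _ _ _).
  rewrite scale1r scaleN1r => /(_ ltac:(lra)) h.
  have {h}: toR R (col j X) = - toR R (col j X).
    apply: h; rewrite x0 (_ : 1 - 2^-1 = 2^-1); last by field.
    by rewrite scalerN subrr.
  move/eqP; rewrite -addr_eq0 -mulr2n -scaler_nat scaler_eq0 (negPf (toR_col_neq0 _ dX)).
  by rewrite orbF pnatr_eq0.
- subst n; split=> [|y z t _ _ _ _]; last by rewrite (flatmx0 y) (flatmx0 z).
  by apply: conv_gen; rewrite (flatmx0 x) inE eqxx.
split=> [|y z t]; first exact: Pmx_col.
rewrite !Pmx_l1 // => Py Pz t01 /(congr1 (mulmx (invmx (toR R X)))).
rewrite -scalemxAr toR_colE mulmxA mulVmx // mul1mx mulmxDr -!scalemxAr.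
set y' := _ *m y in Py *; set z' := _ *m z in Pz * => /matrixP e.
have le1 (v : 'cV[R]_n) : l1 v <= 1 -> `|v j 0| <= 1.
  by apply: le_trans; rewrite /l1 (bigD1 j) //= lerDl sumr_ge0.
have ej : (-1) ^+ b = t * y' j 0 + (1 - t) * z' j 0.
  by move: (e j 0); rewrite !mxE !eqxx mulr1.
have [yj zj] := convex_comb_extreme t01 (le1 _ Py) (le1 _ Pz) (normr_sign _ _) ej.
have zero (v : 'cV[R]_n) : l1 v <= 1 -> v j 0 = (-1) ^+ b -> v = (-1) ^+ b *: delta_mx j 0.
  move=> v1 vj; apply/colP=> i; rewrite !mxE eqxx andbT.
  have [->|ij] := eqVneq i j; first by rewrite mulr1.
  rewrite mulr0; apply/eqP; rewrite -normr_eq0 eq_le normr_ge0 andbT.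
  move: v1; rewrite /l1 (bigD1 j) //= (bigD1 i) //= vj normr_sign => v1.
  have : 0 <= \sum_(k < n | (k != j) && (k != i)) `|v k 0| by apply: sumr_ge0.
  lra.
have : y' = z' by rewrite (zero _ Py yj) (zero _ Pz zj).
by move/(congr1 (mulmx (toR R X))); rewrite !mulmxA mulmxV // !mul1mx.
Qed.

Lemma Pmx_sub n (X X' : 'M[int]_n) x :
  (forall j, exists k (b : bool), col j X' = (-1) ^+ b *: col k X) ->
  Pmx R X' x -> Pmx R X x.
Proof.
move=> h; apply: conv_mono => y /mem_points [->|[j [b ->]]]; apply/mem_points; first by left.
have [k [c ->]] := h j; right; exists k, (b (+) c).
by rewrite toR_sign scalerA signr_addb.
Qed.

Lemma iso_same n (P Q : 'cV[R]_n -> Prop) : same P Q -> iso P Q.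
Proof.
move=> e; exists 1%:M, 1%:M; rewrite mul1mx; split=> //; split=> //; split=> [x|y] v.
  by rewrite toR1 mul1mx; apply/(vertex_same _ e).
by exists y; rewrite toR1 mul1mx; split=> //; apply/(vertex_same _ e).
Qed.

Lemma iso_refl n (P : 'cV[R]_n -> Prop) : iso P P.
Proof. exact: iso_same. Qed.

Lemma iso_trans n m p (P : 'cV[R]_n -> Prop) (Q : 'cV[R]_m -> Prop) (S : 'cV[R]_p -> Prop) :
  iso P Q -> iso Q S -> iso P S.
Proof.
move=> [U [V [VU [UV [h1 h2]]]]] [U' [V' [VU' [UV' [h1' h2']]]]].
exists (U' *m U), (V *m V'); split; last split; last split=> [x v|y /h2' [x [/h2 [z [v ->]] ->]]].
- by rewrite mulmxA -(mulmxA V) VU' mulmx1.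
- by rewrite mulmxA -(mulmxA U') UV mulmx1.
- by rewrite toRM -mulmxA; apply/h1'/h1.
- by exists z; rewrite toRM mulmxA.
Qed.

Lemma iso_sym n m (P : 'cV[R]_n -> Prop) (Q : 'cV[R]_m -> Prop) : iso P Q -> iso Q P.
Proof.
move=> [U [V [VU [UV [h1 h2]]]]]; exists V, U; split=> //; split=> //; split=> [y|x v].
  by move=> /h2 [x [v ->]]; rewrite mulmxA -toRM VU toR1 mul1mx.
by exists (toR R U *m x); rewrite mulmxA -toRM VU toR1 mul1mx; split=> //; apply: h1.
Qed.

Lemma iso_dim n m (P : 'cV[R]_n -> Prop) (Q : 'cV[R]_m -> Prop) : iso P Q -> n = m.
Proof.
move=> [U [V [VU [UV _]]]]; apply/eqP; rewrite eqn_leq.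
by rewrite (mulmx1_min VU) (mulmx1_min UV).
Qed.

Lemma iso_reindex n m (X : 'M[int]_n) (X' : 'M[int]_m) (U : 'M_(m, n)) (V : 'M_(n, m))
    (phi : 'I_m -> 'I_n) :
  \det X != 0 -> \det X' != 0 -> V *m U = 1%:M -> U *m V = 1%:M -> bijective phi ->
  (forall j, col j X' = U *m col (phi j) X) -> iso (Pmx R X) (Pmx R X').
Proof.
move=> dX dX' VU UV [psi psiK phiK] h; exists U, V; split=> //; split=> //.
have nm : n = m by apply/eqP; rewrite eqn_leq (mulmx1_min VU) (mulmx1_min UV).
split=> [x|y]; rewrite vertex_Pmx // => - [n0|[j [b ->]]].
- by apply/vertex_Pmx => //; left; rewrite -nm.
- apply/vertex_Pmx => //; right; exists (psi j), b.
  by rewrite h phiK toRM scalemxAr.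
- exists (toR R V *m y); rewrite mulmxA -toRM UV toR1 mul1mx; split=> //.
  by apply/vertex_Pmx => //; left; rewrite nm.
- exists ((-1) ^+ b *: toR R (col (phi j) X)); rewrite h toRM scalemxAr; split=> //.
  by apply/vertex_Pmx => //; right; exists (phi j), b.
Qed.

Lemma mx_equiv_iso n (X X' : 'M[int]_n) :
  \det X != 0 -> \det X' != 0 -> mx_equiv X X' -> iso (Pmx R X) (Pmx R X').
Proof.
move=> dX dX' [U [s [uU e]]].
apply: (iso_reindex (phi := (s^-1)%g) dX dX' (mulVmx uU) (mulmxV uU)).
  by exists s => k; rewrite ?permKV ?permK.
move=> j; rewrite e -[s]invgK -col_permE invgK; apply/colP=> i.
by rewrite !mxE; apply: eq_bigr => k _; rewrite !mxE.
Qed.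

Lemma iso_simultaneous_reindex n m (X : 'M[int]_n) (phi : 'I_m -> 'I_n) :
  \det X != 0 -> \det (\matrix_(i, j) X (phi i) (phi j)) != 0 -> bijective phi ->
  iso (Pmx R X) (Pmx R (\matrix_(i, j) X (phi i) (phi j))).
Proof.
move=> dX dX' bphi; have iphi := bij_inj bphi.
pose U : 'M[int]_(m, n) := \matrix_(i, k) (phi i == k)%:R.
have UE p (Y : 'M[int]_(n, p)) i j : (U *m Y) i j = Y (phi i) j.
  rewrite mxE (bigD1 (phi i)) //= mxE eqxx mul1r big1 ?addr0 // => k ki.
  by rewrite mxE eq_sym (negPf ki) mul0r.
apply: (@iso_reindex _ _ _ _ U U^T phi) => //.
- apply/matrixP=> i j; case: bphi => psi psiK phiK.
  rewrite !mxE (bigD1 (psi i)) //= big1 => [|k ki]; first by rewrite !mxE phiK eqxx mul1r addr0.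
  rewrite !mxE; case: eqP => [e|]; last by rewrite mul0r.
  by move: ki; rewrite -e psiK eqxx.
- by apply/matrixP=> i j; rewrite UE !mxE (inj_eq iphi) eq_sym.
- by move=> j; apply/colP=> i; rewrite UE !mxE.
Qed.

(** The isomorphism [U] maps columns to columns only up to order and sign. Signs are invisible mod
    2, so a further unimodular [N] removes them; the equivalence is given by [N U]. *)
Lemma iso_mx_equiv n (X X' : 'M[int]_n) :
  reflexive_mx X -> reflexive_mx X' -> iso (Pmx R X) (Pmx R X') -> mx_equiv X X'.
Proof.
move=> rX rX'; have dX := reflexive_det rX; have dX' := reflexive_det rX'.
have [n0|n0] := posnP n.
  move=> _; subst n; rewrite (flatmx0 X') -(flatmx0 X); exact: mx_equiv_refl.
move=> [U [V [VU [UV [_ h]]]]].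
have /fin_all_exists [g hg] (j : 'I_n) : exists kb : 'I_n * bool,
    col j X' = (-1) ^+ kb.2 *: (U *m col kb.1 X).
  have /h [x [+ e]] : vertex (Pmx R X') (toR R (col j X')).
    by apply/vertex_Pmx => //; right; exists j, false; rewrite scale1r.
  case/vertex_Pmx => // [n00|[k [b xe]]]; first by rewrite n00 in n0.
  exists (k, b); apply: (@toR_inj R); rewrite e xe /= toR_sign toRM.
  by rewrite scalemxAr.
have ig : injective (fun j => (g j).1).
  move=> j k /= e; apply: (@col_scale_inj _ X' j k ((-1) ^+ ((g j).2 (+) (g k).2))) => //.
  rewrite [in LHS]hg [in RHS]hg e !toR_sign scalerA -signr_addb addbK //.
pose s := perm ig.
have uU : U \in unitmx := (mulmx1_unit UV).1.
have rX'' := reflexive_perm s^-1 (reflexive_unit_mul uU rX).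
have [|N uN e] := same_modF2_unit_mul rX'' rX'.
  apply/matrixP=> i j; move/colP/(_ i): (hg j).
  rewrite -col_permE !mxE => ->; rewrite permE rmorphM /= rmorph_sign.
  have -> : (-1) ^+ (g j).2 = 1 :> 'F_2 by case: (g j).2 => //; apply: val_inj.
  by rewrite mul1r; congr _%:~R; apply: eq_bigr => k _; rewrite !mxE.
by exists (N *m U), (s^-1)%g; rewrite unitmx_mul uN uU e !mulmxA.
Qed.
End CrossPolytopes.

(** * Reflexivity and facets *)

Section Reflexivity.
Variable R : realType.
Implicit Types (n m : nat).

Lemma pairE n (x y : 'cV[R]_n) : pair x y = (x^T *m y) 0 0.
Proof. by rewrite mxE; apply: eq_bigr => i _; rewrite mxE. Qed.

Lemma pairDr n (x y z : 'cV[R]_n) (a b : R) :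
  pair x (a *: y + b *: z) = a * pair x y + b * pair x z.
Proof. by rewrite !pairE mulmxDr -!scalemxAr !mxE. Qed.

Lemma pairDl n (x y z : 'cV[R]_n) (a b : R) :
  pair (a *: y + b *: z) x = a * pair y x + b * pair z x.
Proof. by rewrite !pairE linearD !linearZ /= mulmxDl -!scalemxAl !mxE. Qed.

Lemma pair_sign n (x y : 'cV[R]_n) (b : bool) : pair x ((-1) ^+ b *: y) = (-1) ^+ b * pair x y.
Proof. by rewrite !pairE -scalemxAr mxE. Qed.

Lemma pair_col n (X : 'M[int]_n) (y : 'cV[R]_n) j :
  pair y (toR R (col j X)) = (y^T *m toR R X) 0 j.
Proof. by rewrite pairE toR_colE mulmxA -colE mxE. Qed.

Lemma dual_convex n (P : 'cV[R]_n -> Prop) : convex (dual P).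
Proof.
by move=> x y t Px Py t01 z Pz; rewrite pairDl; move: (Px z Pz) (Py z Pz) => *; nra.
Qed.

Lemma dual_Pmx n (X : 'M[int]_n) (y : 'cV[R]_n) :
  dual (Pmx R X) y <-> forall j, `|(y^T *m toR R X) 0 j| <= 1.
Proof.
split=> [dy j|h z].
  have h b := dy _ (Pmx_col R X j b); move: (h true) (h false).
  rewrite !pair_sign pair_col expr1 expr0 ler_norml => *; apply/andP; split; lra.
apply: (@conv_min _ _ _ (fun z => -1 <= pair y z)) => [a b t *|{}z].
  by rewrite pairDr; nra.
move=> /mem_points [->|[j [b ->]]]; first by rewrite pairE mulmx0 mxE lerN10.
have := h j; rewrite pair_sign pair_col ler_norml => /andP[*].
by case: b; rewrite ?expr1 ?expr0; lra.
Qed.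

(** Choose the signs independently, the [i]-th with mean [t i]; [w e] is the probability of the
    outcome [e]. *)
Lemma cube_conv n (t : 'I_n -> R) : (forall i, `|t i| <= 1) ->
  exists w : {ffun 'I_n -> bool} -> R, [/\ forall e, 0 <= w e, \sum_e w e = 1 &
    forall k, \sum_e w e * (-1) ^+ e k = t k].
Proof.
move=> t1; pose F i (b : bool) : R := (1 + (-1) ^+ b * t i) / 2.
have F1 i : \sum_b F i b = 1.
  by rewrite big_bool /F expr1 expr0 /=; field.
exists (fun e => \prod_i F i (e i)); split=> [e||k].
- apply: prodr_ge0 => i _; have := t1 i; rewrite ler_norml /F => /andP[*].
  by case: (e i); rewrite ?expr1 ?expr0; lra.
- by rewrite -(bigA_distr_bigA F) big1.
(* [G] inserts the [k]-th sign as a factor, so that the expectation is again a product of sums. *)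
pose G i (b : bool) : R := F i b * (if i == k then (-1) ^+ b else 1).
transitivity (\sum_(e : {ffun 'I_n -> bool}) \prod_i G i (e i)).
  apply: eq_bigr => e _; rewrite [RHS]big_split /=; congr (_ * _).
  by rewrite [RHS](bigD1 k) //= eqxx big1 ?mulr1 // => i /negPf ->.
rewrite -(bigA_distr_bigA G) (bigD1 k) //= [X in _ * X]big1 ?mulr1 => [|i ik].
  by rewrite big_bool /G /F eqxx expr1 expr0 /=; field.
by rewrite -[RHS](F1 i); apply: eq_bigr => b _; rewrite /G (negPf ik) mulr1.
Qed.

Lemma lattice_polytope_Pmx n (X : 'M[int]_n) : lattice_polytope (Pmx R X).
Proof.
exists (0 :: [seq col j X | j <- enum 'I_n] ++ [seq - col j X | j <- enum 'I_n]) => x.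
rewrite /= map_cat -2!map_comp /Pmx.
have -> : toR R (0 : 'cV[int]_n) = 0 by apply/colP=> i; rewrite !mxE.
have -> : [seq - toR R (col j X) | j <- enum 'I_n] =
    [seq (toR R \o (fun j => - col j X)) i | i <- enum 'I_n].
  by apply: eq_map => j; apply/colP=> i; rewrite !mxE rmorphN.
exact: iff_refl.
Qed.

Lemma zero_interior_Pmx n (X : 'M[int]_n) : \det X != 0 -> zero_interior (Pmx R X).
Proof.
(* The l1 norm of [Y x] is at most [c] times the sup norm of [x]; adding 1 avoids dividing by
   [c = 0] in dimension 0. *)
move=> dX; pose Y := invmx (toR R X); pose c := \sum_j \sum_i `|Y j i|.
have c0 : 0 <= c by do 2!(apply: sumr_ge0 => ? _).
have d0 : 0 < 1 + c by lra.
exists (1 + c)^-1; split=> [|x hx]; first by rewrite invr_gt0.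
apply/Pmx_l1 => //; apply: (@le_trans _ _ (c / (1 + c))).
  rewrite /c mulr_suml; apply: ler_sum => j _; rewrite mulr_suml mxE.
  apply: le_trans (ler_norm_sum _ _ _) _; apply: ler_sum => i _.
  by rewrite normrM ler_wpM2l.
by rewrite ler_pdivrMr // mul1r; lra.
Qed.

Lemma Fano_Pmx n (X : 'M[int]_n) : reflexive_mx X -> Fano (Pmx R X).
Proof.
move=> rX; have dX := reflexive_det rX.
split; first exact: lattice_polytope_Pmx.
split; first exact: zero_interior_Pmx.
move=> x /vertex_Pmx -/(_ dX) [n0|[j [b ->]] _].
  by subst n; rewrite (flatmx0 x) eqxx.
exists ((-1) ^+ b *: col j X); split=> [|k w e]; first by rewrite toR_sign.
case: rX => W [u [_ _ uX]].
(* [u] takes the value 1 or -1 on every vertex, so an integer dividing a vertex divides 1. *)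
have : (u *m ((-1) ^+ b *: col j X)) 0 0 = (-1) ^+ b.
  by rewrite -scalemxAr colE mulmxA uX -colE !mxE mulr1.
rewrite e -scalemxAr mxE; set z := (u *m w) 0 0 => kz.
have {kz} : absz (k * z) = 1%N by rewrite kz; case: b {e kz}.
rewrite abszM => /eqP; rewrite muln_eq1 => /andP[/eqP k1 _]; lia.
Qed.

Lemma reflexive_Pmx n (X : 'M[int]_n) : reflexive_mx X -> is_reflexive (Pmx R X).
Proof.
move=> rX; split; first exact: Fano_Pmx.
have uX := toR_unit R (reflexive_det rX); case: rX => W [u rX].
pose y (e : {ffun 'I_n -> bool}) : 'cV[int]_n := (u - (\row_j (e j)%:R) *m W)^T.
have yX e : (toR R (y e))^T *m toR R X = \row_j (-1) ^+ e j.
  have -> : (toR R (y e))^T = toR R (u - (\row_j (e j)%:R) *m W).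
    by apply/matrixP=> i j; rewrite !mxE.
  rewrite -toRM (reflexive_sign_row e rX); apply/matrixP=> i j.
  by rewrite !mxE rmorph_sign.
exists [seq y e | e : {ffun 'I_n -> bool}] => x; split.
  move/dual_Pmx => /cube_conv [w [w0 w1 wk]].
  have -> : x = \sum_e w e *: toR R (y e).
    apply: trmx_inj; apply: (can_inj (mulmxK uX)); apply/rowP=> k.
    rewrite -wk linear_sum mulmx_suml summxE; apply: eq_bigr => e _.
    by rewrite linearZ /= -scalemxAl yX !mxE.
  by apply: conv_fin => // e; apply/map_f/image_f.
apply: conv_min (@dual_convex _ _) _ => _ /mapP [_ /imageP [e _ ->] ->].
by apply/dual_Pmx => j; rewrite yX mxE normr_sign.
Qed.

(* The vertices of the dual parallelepiped are the [x] with [x^T V = e], [e] a sign vector;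
   they must be lattice points. *)
Lemma reflexive_Pmx_inv n (P : 'cV[R]_n -> Prop) (V : 'M[int]_n) :
  \det V != 0 -> same P (Pmx R V) -> is_reflexive P -> reflexive_mx V.
Proof.
move=> dV PV [_ [s hs]]; have uV := toR_unit R dV.
have dualP y : dual P y <-> forall j, `|(y^T *m toR R V) 0 j| <= 1.
  by rewrite -dual_Pmx; split=> h z /PV; apply: h.
have sgn (e : 'I_n -> bool) : exists x : 'rV[int]_n, x *m V = \row_j (-1) ^+ e j.
  pose y : 'cV[R]_n := ((\row_j (-1) ^+ e j) *m invmx (toR R V))^T.
  have yV : y^T *m toR R V = \row_j (-1) ^+ e j by rewrite trmxK mulmxKV.
  have vy : vertex (dual P) y.
    split=> [|a b t /dualP da /dualP db t01 yab].
      by apply/dualP => j; rewrite yV mxE normr_sign.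
    apply: trmx_inj; apply: (can_inj (mulmxK uV)); apply/rowP=> j.
    have : (y^T *m toR R V) 0 j = t * (a^T *m toR R V) 0 j + (1 - t) * (b^T *m toR R V) 0 j.
      by rewrite yab linearD !linearZ /= mulmxDl -!scalemxAl !mxE.
    move/(convex_comb_extreme t01 (da j) (db j)); rewrite yV mxE normr_sign.
    by case=> // -> ->.
  have /vertex_conv /mapP [x _ ex] := (vertex_same y hs).1 vy.
  exists x^T; apply: (@toR_inj R); rewrite toRM.
  have -> : toR R x^T = y^T by rewrite ex; apply/matrixP=> i j; rewrite !mxE.
  by rewrite yV; apply/matrixP=> i j; rewrite !mxE rmorph_sign.
have [u hu] := sgn (fun=> false).
have /fin_all_exists [q hq] k := sgn (fun j => j == k).
(* The dual vertices for the all-one sign vector and for the one with -1 only at [k] differ by row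
   [k] of [2 V^-1]. *)
pose W : 'M[int]_n := \matrix_k (u - q k).
have WV : W *m V = 2%:M.
  apply/row_matrixP => k; rewrite row_mul rowK mulmxBl hu hq; apply/rowP=> j.
  by rewrite !mxE eq_sym; case: eqP.
exists W, u; split=> //; first exact: half_inverseC.
by rewrite hu; apply/rowP=> j; rewrite !mxE.
Qed.

Lemma reflexive_cs_cross n (P : 'cV[R]_n -> Prop) : is_reflexive P -> cs_cross P ->
  exists2 V, reflexive_mx V & same P (Pmx R V).
Proof. by move=> rP [V [dV PV]]; exists V => //; apply: reflexive_Pmx_inv rP. Qed.

(** A proper combination that attains the minimum [c] has both ends at the minimum, hence in the
    face. *)
Lemma vertex_face n (P F : 'cV[R]_n -> Prop) (u : 'cV[R]_n) (c : R) x :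
  (forall y, P y -> c <= pair u y) -> (forall x, F x <-> P x /\ pair u x = c) ->
  vertex F x <-> vertex P x /\ pair u x = c.
Proof.
move=> cP hF; split=> [[/hF [Px ux] v]|[[Px v] ux]].
  split=> //; split=> // y z t Py Pz t01 e.
  have uyz : c = t * pair u y + (1 - t) * pair u z by rewrite -pairDr -e.
  case/andP: (t01) => t0 t1; move: (cP y Py) (cP z Pz) => cy cz.
  by apply: (v y z t) => //; apply/hF; split=> //; nra.
split=> [|y z t /hF [Py _] /hF [Pz _]]; first exact/hF.
exact: v.
Qed.

(* If some [|u V_j|] were smaller than [-c], all points of the face would have vanishing
   [j]-th coordinate, and [n] such points cannot be affinely independent. *)
Lemma facet_pairing n (P F : 'cV[R]_n -> Prop) (V : 'M[int]_n) : (0 < n)%N ->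
  \det V != 0 -> same P (Pmx R V) -> facet P F ->
  exists (u : 'cV[R]_n) (c : R), [/\ c < 0, forall y, P y -> c <= pair u y,
    forall x, F x <-> P x /\ pair u x = c &
    forall j, `|pair u (toR R (col j V))| = - c].
Proof.
move=> n0 dV PV [[u [c [u0 [cP hF]]]] [p [Fp indep]]]; have uV := toR_unit R dV.
pose a j := pair u (toR R (col j V)).
have aE : u^T *m toR R V = \row_j a j by apply/rowP=> j; rewrite [RHS]mxE -pair_col.
have ac j : `|a j| <= - c.
  have h b := cP _ ((PV _).2 (Pmx_col R V j b)); move: (h true) (h false).
  rewrite !pair_sign -/(a j) expr1 expr0 ler_norml => *; apply/andP; split; lra.
have c0 : c < 0.
  rewrite ltNge; apply/negP => c0; case/eqP: u0.
  apply: trmx_inj; apply: (can_inj (mulmxK uV)); rewrite aE trmx0 mul0mx.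
  apply/rowP=> j; rewrite !mxE; apply/eqP; rewrite -normr_eq0 eq_le normr_ge0 andbT.
  by apply: le_trans (ac j) _; lra.
exists u, c; split=> // j; apply/eqP; rewrite eq_le ac leNgt; apply/negP => aj.
pose t i := invmx (toR R V) *m p i.
have tj i : t i j 0 = 0.
  have [/PV /Pmx_l1 -/(_ dV) t1 uc] := (hF _).1 (Fp i).
  rewrite -/(t i) in t1.
  have e : \sum_k a k * t i k 0 = c.
    rewrite -uc -[p i]mul1mx -(mulmxV uV) -mulmxA -/(t i) pairE mulmxA aE mxE.
    by apply: eq_bigr => k _; rewrite !mxE.
  (* Each term is nonnegative as [|a k| <= - c], while the sum is at most 0 as [l1 (t i) <= 1]. So
     all terms vanish, and [|a j| < - c] leaves only [t i j 0 = 0]. *)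
  have ge k : 0 <= - c * `|t i k 0| + a k * t i k 0.
    have := ac k; rewrite ler_norml => /andP[a1 a2].
    by case: (ger0P (t i k 0)) => ?; nra.
  have le : \sum_k (- c * `|t i k 0| + a k * t i k 0) <= 0.
    rewrite big_split /= e -mulr_sumr -/(l1 (t i)); nra.
  have : \sum_k (- c * `|t i k 0| + a k * t i k 0) = 0.
    by apply/eqP; rewrite eq_le le sumr_ge0.
  move/psumr_eq0P => /(_ (fun k _ => ge k)) /(_ j isT).
  have := aj; rewrite -/(a j) ltr_norml => /andP[b1 b2].
  by case: (ger0P (t i j 0)) => ? ?; nra.
pose T : 'M[R]_n := \matrix_(k, i) t i k 0.
have : ~~ row_free T^T.
  rewrite /row_free mxrank_tr; apply/negP => /eqP rT.
  have : row_free T by rewrite /row_free rT.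
  rewrite row_free_unit => uT; have := mulmxV uT => /matrixP /(_ j j).
  rewrite mxE big1 => [|i _]; last by rewrite [T _ _]mxE tj mul0r.
  by rewrite mxE eqxx => /eqP; rewrite eq_sym oner_eq0.
rewrite -kermx_eq0 => /rowV0Pn [v /sub_kermxP vT v0].
have Tv : \sum_i v 0 i *: t i = 0.
  apply/colP=> k; rewrite summxE; move/rowP/(_ k): vT; rewrite !mxE => e.
  by rewrite -[RHS]e; apply: eq_bigr => i _; rewrite !mxE.
have pv : \sum_i v 0 i *: p i = 0.
  transitivity (toR R V *m \sum_i v 0 i *: t i); last by rewrite Tv mulmx0.
  rewrite mulmx_sumr; apply: eq_bigr => i _.
  by rewrite -scalemxAr mulmxA mulmxV // mul1mx.
case/eqP: v0; apply/rowP=> i; rewrite [RHS]mxE; apply: indep i => //.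
(* Pairing the linear relation with [u], which equals [c] on every [p i], shows that its
   coefficients sum to 0. *)
apply: (@mulfI _ c); first by rewrite lt_eqF.
transitivity (pair u (\sum_i v 0 i *: p i)); last by rewrite pv pairE mulmx0 mxE mulr0.
rewrite pairE mulmx_sumr summxE mulr_sumr; apply: eq_bigr => i _.
by rewrite -scalemxAr mxE -pairE ((hF _).1 (Fp i)).2 mulrC.
Qed.

Lemma facet_wirth n (P F : 'cV[R]_n -> Prop) : (0 < n)%N ->
  is_reflexive P -> cs_cross P -> facet P F ->
  exists B A : 'M[int]_n, [/\ B \in unitmx, wirth A,
    forall x, vertex F x <-> exists j, x = toR R (col j (B *m A)) &
    same P (Pmx R (B *m A))].
Proof.
move=> n0 rP csP fF; have [V rV PV] := reflexive_cs_cross rP csP.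
have dV := reflexive_det rV.
have [u [c [c0 cP hF ac]]] := facet_pairing n0 dV PV fF.
pose e j := 0 < pair u (toR R (col j V)).
(* As [c < 0], the facet contains the negative of a column exactly when [u] is positive on that
   column. *)
have ec j (b : bool) : pair u ((-1) ^+ b *: toR R (col j V)) = c <-> b = e j.
  rewrite pair_sign; have := ac j; rewrite /e.
  by case: (ltrgt0P (pair u _)) => h hc; case: b; rewrite ?expr1 ?expr0; split=> //; lra.
have [B [A [s [uB wA eBA]]]] := wirth_form n0 (reflexive_sign e rV).
exists B, A.
have colBA j : col j (B *m A) = (-1) ^+ e (s^-1 j)%g *: col ((s^-1)%g j) V.
  rewrite -eBA -[s]invgK -col_permE invgK mul_mx_diag; apply/colP=> i; rewrite !mxE.
  by rewrite mulrC.
split=> // [x|x].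
  rewrite (vertex_face _ cP hF) (vertex_same _ PV) (vertex_Pmx _ dV); split.
    case=> [[n00|[j [b ->]]]]; first by rewrite n00 in n0.
    by move/ec=> ->; exists (s j); rewrite colBA permK toR_sign.
  move=> [j ->]; rewrite colBA toR_sign; split; last exact/ec.
  by right; do 2!eexists.
rewrite PV; split; apply: Pmx_sub => j; last by rewrite colBA; do 2!eexists.
exists (s j), (e j); rewrite colBA permK scalerA -signr_addb addbb.
by rewrite scale1r.
Qed.
End Reflexivity.

(** * Free sums with a segment *)

Section FreeSums.
Variable R : realType.
Implicit Types (n m : nat).

Lemma segP (y : 'cV[R]_1) : @seg R y <-> `|y 0 0| <= 1.
Proof.
split.
  apply: (@conv_min _ _ _ (fun z : 'cV[R]_1 => `|z 0 0| <= 1)) => [a b t|{}y].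
    rewrite !ler_norml !mxE => /andP[? ?] /andP[? ?] /andP[? ?]; apply/andP; split; nra.
  by rewrite !inE => /orP[] /eqP ->; rewrite mxE ?normrN normr1.
rewrite ler_norml => /andP[y0 y1].
have -> : y = ((1 + y 0 0) / 2) *: const_mx 1 + (1 - (1 + y 0 0) / 2) *: const_mx (-1).
  by apply/colP=> i; rewrite !mxE ord1; field.
by apply: conv_two; rewrite ?inE ?eqxx ?orbT //; apply/andP; split; lra.
Qed.

Lemma seg_Pmx : same (@seg R) (Pmx R (1%:M : 'M_1)).
Proof.
move=> x; rewrite segP Pmx_l1 ?det1 ?oner_eq0 //.
by rewrite toR1 invmx1 mul1mx /l1 big_ord1.
Qed.

Lemma Fano_same n (P Q : 'cV[R]_n -> Prop) : same P Q -> Fano Q -> Fano P.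
Proof.
move=> PQ [[s hs] [[e [e0 he]] hv]]; split; last split.
- by exists s => x; rewrite PQ.
- by exists e; split=> // x /he /PQ.
- by move=> x /(vertex_same _ PQ); apply: hv.
Qed.

Lemma Fano_seg : Fano (@seg R).
Proof.
apply: Fano_same seg_Pmx _; apply: Fano_Pmx.
exists 2%:M, 1%:M; split; rewrite ?mulmx1 ?mul1mx //.
by apply/matrixP=> i j; rewrite !mxE !ord1.
Qed.

Lemma Fano_convex n (P : 'cV[R]_n -> Prop) : Fano P -> convex P.
Proof.
move=> [[s hs] _] x y t /hs Px /hs Py t01; apply/hs; exact: conv_convex.
Qed.

Lemma Fano0 n (P : 'cV[R]_n -> Prop) : Fano P -> P 0.
Proof. by move=> [_ [[e [e0 he]] _]]; apply: he => i; rewrite mxE normr0 ltW. Qed.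

(** [a] is the segment coordinate and [b] the total weight on [Q]. For [b = 0] the vector [q] is
    arbitrary, so no point of [Q] has to be supplied. *)
Lemma freesum_segW n (Q : 'cV[R]_n -> Prop) x : convex Q -> freesum (@seg R) Q x ->
  exists (a b : R) q, [/\ 0 <= b, `|a| + b <= 1, Q q \/ b = 0 & x = col_mx (const_mx a) (b *: q)].
Proof.
move=> cQ; apply: (@conv_min _ _ _ (fun x => exists (a b : R) q,
  [/\ 0 <= b, `|a| + b <= 1, Q q \/ b = 0 & x = col_mx (const_mx a) (b *: q)])) => [|{}x].
  move=> _ _ t [a1 [b1 [q1 [b10 ab1 Q1 ->]]]] [a2 [b2 [q2 [b20 ab2 Q2 ->]]]] /andP[t0 t1].
  pose a := t * a1 + (1 - t) * a2; pose b := t * b1 + (1 - t) * b2.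
  have b0 : 0 <= b by rewrite /b; nra.
  have ab : `|a| + b <= 1.
    have : `|a| <= t * `|a1| + (1 - t) * `|a2|.
      apply: le_trans (ler_normD _ _) _; rewrite !normrM (ger0_norm t0).
      by rewrite (@ger0_norm _ (1 - t)) ?subr_ge0.
    by rewrite /b; nra.
  have eD (v1 v2 : 'cV[R]_n) : t *: col_mx (const_mx a1) v1 + (1 - t) *: col_mx (const_mx a2) v2
      = col_mx (const_mx a) (t *: v1 + (1 - t) *: v2).
    rewrite !scale_col_mx add_col_mx; congr col_mx.
    by apply/colP=> i; rewrite !mxE.
  rewrite eD; exists a, b; have [bz|bnz] := eqVneq b 0.
    exists 0; split=> //; [by right | congr col_mx].
    have [/eqP z1 /eqP z2] : t * b1 = 0 /\ (1 - t) * b2 = 0 by move: bz; rewrite /b; split; nra.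
    by rewrite !scalerA (eqP z1) (eqP z2) !scale0r addr0 scaler0.
  have bp : 0 < b by rewrite lt_neqAle eq_sym bnz.
  exists ((t * b1 / b) *: q1 + (1 - t * b1 / b) *: q2).
  have e1 : b * (t * b1 / b) = t * b1 by field.
  have e2 : b * (1 - t * b1 / b) = (1 - t) * b2 by rewrite mulrBr e1 /b; ring.
  split=> //; last by rewrite scalerDr !scalerA e1 e2.
  left; have tb0 : 0 <= t * b1 by apply: mulr_ge0.
  have tb2 : 0 <= (1 - t) * b2 by apply: mulr_ge0 => //; lra.
  case: Q1 => [Q1|b1z]; last first.
    case: Q2 => [Q2|b2z]; last by case/eqP: bnz; rewrite /b b1z b2z; ring.
    by rewrite b1z mulr0 mul0r scale0r add0r subr0 scale1r.
  case: Q2 => [Q2|b2z]; last first.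
    rewrite (_ : t * b1 / b = 1) ?subrr ?scale0r ?addr0 ?scale1r //.
    by move: bnz; rewrite /b b2z mulr0 addr0 => ?; apply: mulfV.
  apply: cQ => //; rewrite divr_ge0 //= ler_pdivrMr // mul1r /b; lra.
case=> [[y [/segP y1 ->]]|[z [Qz ->]]].
  exists (y 0 0), 0, 0; rewrite addr0 lexx; split=> //; first by right.
  by rewrite scaler0; congr col_mx; apply/colP=> i; rewrite !mxE ord1.
exists 0, 1, z; rewrite normr0 add0r lexx ler01; split=> //; first by left.
by rewrite scale1r; congr col_mx; apply/colP=> i; rewrite !mxE.
Qed.

Lemma freesum_left n (Q : 'cV[R]_n -> Prop) (a : R) : `|a| <= 1 ->
  freesum (@seg R) Q (col_mx (const_mx a) 0).
Proof. by move=> a1; apply: conv_gen; left; exists (const_mx a); rewrite segP mxE. Qed.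

Lemma freesum_right n (Q : 'cV[R]_n -> Prop) q : Q q -> freesum (@seg R) Q (col_mx 0 q).
Proof. by move=> Qq; apply: conv_gen; right; exists q. Qed.

(** The condition [q != 0] matters for 0-dimensional [Q]: its vertex 0 becomes an inner point of the
    segment. *)
Lemma vertex_freesum_segW n (Q : 'cV[R]_n -> Prop) x : vertex (freesum (@seg R) Q) x ->
  (exists b : bool, x = col_mx (const_mx ((-1) ^+ b)) 0) \/
  exists q, [/\ vertex Q q, q != 0 & x = col_mx 0 q].
Proof.
move=> vx.
have pm (a : R) : -1 < a < 1 -> x <> col_mx (const_mx a) 0.
  move=> /andP[a0 a1] e; case: vx => _ vx.
  have := vx (col_mx (const_mx 1) 0) (col_mx (const_mx (-1)) 0) ((1 + a) / 2).
  case/(_ _ _ _ _)/eq_col_mx.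
  - by apply: freesum_left; rewrite normr1.
  - by apply: freesum_left; rewrite normrN1.
  - by apply/andP; split; lra.
  - rewrite e !scale_col_mx add_col_mx !scaler0 addr0; congr col_mx.
    by apply/colP=> i; rewrite !mxE; field.
  by move=> /matrixP /(_ 0 0); rewrite !mxE => h _; lra.
case: (vertex_conv vx) => [[y [/segP y1 ex]]|[q [Qq ex]]].
  left; have ey : y = const_mx (y 0 0) by apply/colP=> i; rewrite !mxE ord1.
  have [y11|y1n] := eqVneq (y 0 0) 1; first by exists false; rewrite ex ey y11.
  have [ym|yn] := eqVneq (y 0 0) (-1); first by exists true; rewrite ex ey ym.
  case: (pm (y 0 0)); last by rewrite -ey.
  by move: y1; rewrite ler_norml !lt_neqAle y1n eq_sym yn.
right; exists q; split=> //.
  split=> // y z t Qy Qz t01 eq_.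
  have := vx.2 (col_mx 0 y) (col_mx 0 z) t (freesum_right Qy) (freesum_right Qz) t01.
  case/(_ _)/eq_col_mx => //.
  by rewrite ex eq_ !scale_col_mx add_col_mx !scaler0 addr0.
apply/eqP=> q0; apply: (pm 0); first by apply/andP; split; lra.
by rewrite ex q0; congr col_mx; apply/colP=> i; rewrite !mxE.
Qed.

Lemma vertex_freesum_left n (Q : 'cV[R]_n -> Prop) (b : bool) : convex Q ->
  vertex (freesum (@seg R) Q) (col_mx (const_mx ((-1) ^+ b)) 0).
Proof.
move=> cQ; split=> [|y z t]; first by apply: freesum_left; rewrite normr_sign.
move=> /(freesum_segW cQ) [a1 [b1 [q1 [b10 ab1 _ ->]]]].
move=> /(freesum_segW cQ) [a2 [b2 [q2 [b20 ab2 _ ->]]]] t01.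
rewrite !scale_col_mx add_col_mx => /eq_col_mx [+ _].
move=> /matrixP /(_ 0 0); rewrite !mxE => e.
have n1 : `|a1| <= 1 by lra.
have n2 : `|a2| <= 1 by lra.
have [e1 e2] := convex_comb_extreme t01 n1 n2 (normr_sign _ _) e.
have : b1 = 0 by move: ab1; rewrite e1 normr_sign; lra.
have : b2 = 0 by move: ab2; rewrite e2 normr_sign; lra.
by move=> -> ->; rewrite e1 e2 !scale0r.
Qed.

Lemma vertex_freesum_right n (Q : 'cV[R]_n -> Prop) q : convex Q -> Q 0 ->
  vertex Q q -> q != 0 -> vertex (freesum (@seg R) Q) (col_mx 0 q).
Proof.
move=> cQ Q0 [Qq vq] q0; split=> [|y z t]; first exact: freesum_right.
move=> /(freesum_segW cQ) [a1 [b1 [q1 [b10 ab1 Q1 ->]]]].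
move=> /(freesum_segW cQ) [a2 [b2 [q2 [b20 ab2 Q2 ->]]]] t01.
rewrite !scale_col_mx add_col_mx => /eq_col_mx [_ e].
have scQ (a b : R) p : 0 <= b -> `|a| + b <= 1 -> Q p \/ b = 0 -> Q (b *: p).
  move=> b0 ab [Qp|->]; last by rewrite scale0r.
  have := cQ p 0 b Qp Q0; rewrite scaler0 addr0; apply.
  by rewrite b0; have := normr_ge0 a; lra.
have e12 := vq _ _ t (scQ _ _ _ b10 ab1 Q1) (scQ _ _ _ b20 ab2 Q2) t01 e.
have eq2 : q = b2 *: q2 by rewrite e e12 -scalerDl addrC subrK scale1r.
have eq1 : q = b1 *: q1 by rewrite e12.
(* For [0 < b < 1] the vertex [q = b p] would lie strictly between [p] and 0. So [b = 1], and no
   weight is left for the segment. *)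
have a0 (a b : R) p : 0 <= b -> `|a| + b <= 1 -> Q p \/ b = 0 -> q = b *: p -> a = 0.
  move=> b0 ab Qp qp; have na := normr_ge0 a.
  have [b1_|bn1] := eqVneq b 1; first by apply/normr0_eq0; lra.
  have [bz|bn0] := eqVneq b 0; first by case/eqP: q0; rewrite qp bz scale0r.
  case: Qp => [Qp|/eqP]; last by rewrite (negPf bn0).
  have := vq p 0 b Qp Q0; rewrite scaler0 addr0 => /(_ _ qp) p0.
  case/eqP: q0; rewrite qp p0 ?scaler0 // !lt_neqAle bn1 eq_sym bn0 b0 /=; lra.
by rewrite (a0 _ _ _ b10 ab1 Q1 eq1) (a0 _ _ _ b20 ab2 Q2 eq2) e12.
Qed.

Lemma toR_col_block1_left n (Z : 'M[int]_n) (j : 'I_1) (b : bool) :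
  (-1) ^+ b *: toR R (col (lshift n j) (block_mx (1%:M : 'M_1) 0 0 Z)) =
  col_mx (const_mx ((-1) ^+ b)) 0.
Proof.
have -> : toR R (col (lshift n j) (block_mx (1%:M : 'M_1) 0 0 Z)) = col_mx (const_mx 1) 0.
  apply/colP=> i; rewrite [LHS]mxE [col _ _ _ _]mxE; case: (split_ordP i) => k ->.
    by rewrite block_mxEul col_mxEu !mxE !ord1.
  by rewrite block_mxEdl col_mxEd !mxE.
rewrite scale_col_mx scaler0; congr col_mx.
by apply/colP=> i; rewrite !mxE mulr1.
Qed.

Lemma toR_col_block1_right n (Z : 'M[int]_n) (k : 'I_n) (b : bool) :
  (-1) ^+ b *: toR R (col (rshift 1 k) (block_mx (1%:M : 'M_1) 0 0 Z)) =
  col_mx 0 ((-1) ^+ b *: toR R (col k Z)).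
Proof.
rewrite -[X in col_mx X _](scaler0 _ ((-1) ^+ b)) -scale_col_mx; congr (_ *: _).
apply/colP=> i; rewrite [LHS]mxE [col _ _ _ _]mxE; case: (split_ordP i) => l ->.
  by rewrite block_mxEur col_mxEu !mxE.
by rewrite block_mxEdr col_mxEd !mxE.
Qed.

Lemma iso_freesum_seg n m (Q : 'cV[R]_n -> Prop) (Z : 'M[int]_m) : Fano Q -> \det Z != 0 ->
  iso Q (Pmx R Z) -> iso (freesum (@seg R) Q) (Pmx R (block_mx (1%:M : 'M_1) 0 0 Z)).
Proof.
move=> fQ dZ [U [V [VU [UV [h1 h2]]]]]; have cQ := Fano_convex fQ; have Q0 := Fano0 fQ.
have dB : \det (block_mx (1%:M : 'M_1) 0 0 Z) != 0 by rewrite det_ublock det1 mul1r.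
exists (block_mx 1%:M 0 0 U), (block_mx 1%:M 0 0 V).
have toRb (x : 'cV[R]_1) (y : 'cV[R]_n) :
    toR R (block_mx (1%:M : 'M_1) 0 0 U) *m col_mx x y = col_mx x (toR R U *m y).
  have -> : toR R (block_mx (1%:M : 'M_1) 0 0 U) = block_mx 1%:M 0 0 (toR R U).
    rewrite /toR map_block_mx; congr block_mx; last first.
    - by apply/matrixP=> i j; rewrite !mxE.
    - by apply/matrixP=> i j; rewrite !mxE.
    - exact: toR1.
  by rewrite mul_block_col !mul0mx mul1mx addr0 add0r.
split; first by rewrite mulmx_block !mul0mx !mulmx0 mulmx1 VU !addr0 add0r -scalar_mx_block.
split; first by rewrite mulmx_block !mul0mx !mulmx0 mulmx1 UV !addr0 add0r -scalar_mx_block.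
split=> [x /vertex_freesum_segW [[b ->]|[q [vq q0 ->]]]|y /(vertex_Pmx _ dB)].
- rewrite toRb mulmx0; apply/vertex_Pmx => //; right; exists (lshift m 0), b.
  by rewrite toR_col_block1_left.
- rewrite toRb; apply/vertex_Pmx => //; right.
  case/vertex_Pmx: (h1 q vq) => // [m0|[k [b ->]]].
    case/eqP: q0; rewrite -[q]mul1mx -toR1 -VU toRM -mulmxA.
    by move: (toR R U *m q) => w; subst m; rewrite (flatmx0 w) mulmx0.
  by exists (rshift 1 k), b; rewrite toR_col_block1_right.
case=> [//|[j [b ->]]]; case: (split_ordP j) => k ->.
  exists (col_mx (const_mx ((-1) ^+ b)) 0); rewrite toRb mulmx0 toR_col_block1_left.
  by split=> //; apply: vertex_freesum_left.
have /h2 [q [vq e]] : vertex (Pmx R Z) ((-1) ^+ b *: toR R (col k Z)).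
  by apply/vertex_Pmx => //; right; exists k, b.
exists (col_mx 0 q); rewrite toRb toR_col_block1_right e; split=> //.
apply: vertex_freesum_right => //; apply/eqP=> q0.
move/eqP: e; rewrite q0 mulmx0 scale_sign_eq0 (negPf (toR_col_neq0 _ _ dZ)) //.
Qed.

Lemma splits_segs_unit_ext n (P : 'cV[R]_n -> Prop) n' (P' : 'cV[R]_n' -> Prop) r
    m (Y : 'M[int]_m) :
  splits_segs P P' r -> reflexive_mx Y -> iso P' (Pmx R Y) -> iso P (Pmx R (unit_ext r Y)).
Proof.
move=> h rY; elim: h => {n P n' P' r} [n P n' P' iPP'|n P n2 Q n' P' r [_ [fQ iPQ]] _ IH] iY.
  exact: iso_trans iPP' iY.
apply: iso_trans iPQ _; apply: iso_freesum_seg fQ _ (IH iY).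
by apply: reflexive_det; apply/reflexive_unit_ext.
Qed.

Lemma splits_seg_block1 n (P : 'cV[R]_n -> Prop) m (Z : 'M[int]_m) : reflexive_mx Z ->
  iso P (Pmx R (block_mx (1%:M : 'M_1) 0 0 Z)) -> splits P (@seg R) (Pmx R Z).
Proof.
move=> rZ iP; split; [exact: Fano_seg | split; first exact: Fano_Pmx].
apply: iso_trans iP (iso_sym _); apply: iso_freesum_seg (iso_refl _).
  exact: Fano_Pmx.
exact: reflexive_det.
Qed.

Lemma unit_ext_splits_segs n (P : 'cV[R]_n -> Prop) r m (Y : 'M[int]_m) :
  reflexive_mx Y -> iso P (Pmx R (unit_ext r Y)) -> splits_segs P (Pmx R Y) r.
Proof.
move=> rY; elim: r n P => [|r IH] n P iP; first exact: splits_segs0.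
apply: (@splits_segsS _ _ _ _ (Pmx R (unit_ext r Y))); last exact: IH (iso_refl _).
by apply: splits_seg_block1 => //; apply/reflexive_unit_ext.
Qed.

Lemma one_irreducible_iso n m (P : 'cV[R]_n -> Prop) (Q : 'cV[R]_m -> Prop) :
  iso P Q -> one_irreducible P -> one_irreducible Q.
Proof.
move=> iPQ irr [n2 [S [f1 [f2 i]]]]; apply: irr; exists n2, S; split=> //; split=> //.
exact: iso_trans iPQ i.
Qed.

Lemma iso_block1_cancel n m (X : 'M[int]_n) (Y : 'M[int]_m) :
  reflexive_mx X -> reflexive_mx Y ->
  iso (Pmx R (block_mx (1%:M : 'M_1) 0 0 X)) (Pmx R (block_mx (1%:M : 'M_1) 0 0 Y)) ->
  iso (Pmx R X) (Pmx R Y).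
Proof.
move=> rX rY i; have /eqP := iso_dim i; rewrite eqn_add2l => /eqP nm; subst m.
apply: mx_equiv_iso; try exact: reflexive_det.
apply: mx_equiv_block1_cancel => //; apply: iso_mx_equiv i; exact/reflexive_block1.
Qed.

(** Segments are cancelled in pairs; if one side ran out first, a 1-irreducible polytope would still
    split off a segment. *)
Lemma unit_ext_unique r1 r2 n1 n2 (Y1 : 'M[int]_n1) (Y2 : 'M[int]_n2) :
  reflexive_mx Y1 -> reflexive_mx Y2 ->
  one_irreducible (Pmx R Y1) -> one_irreducible (Pmx R Y2) ->
  iso (Pmx R (unit_ext r1 Y1)) (Pmx R (unit_ext r2 Y2)) ->
  r1 = r2 /\ iso (Pmx R Y1) (Pmx R Y2).
Proof.
move=> rY1 rY2 irr1 irr2; elim: r1 r2 => [|r1 IH] [|r2] //= i.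
- case: irr1; exists (r2 + n2)%N, (Pmx R (unit_ext r2 Y2)).
  by apply: splits_seg_block1 => //; apply/reflexive_unit_ext.
- case: irr2; exists (r1 + n1)%N, (Pmx R (unit_ext r1 Y1)).
  by apply: splits_seg_block1; [apply/reflexive_unit_ext | exact: iso_sym].
have [|-> //] := IH r2.
by apply: iso_block1_cancel i; apply/reflexive_unit_ext.
Qed.

(* A splitting off of [-1,1] yields an integral functional [l] with [l B A] equal to plus or
   minus a unit row, which a 1-minimal matrix does not allow. *)
Lemma wirth_1min_irreducible n (A B : 'M[int]_n) : wirth_1min A -> B \in unitmx ->
  one_irreducible (Pmx R (B *m A)).
Proof.
move=> mA uB [n2 [Q [_ [_ [U [V [VU [UV [h _]]]]]]]]].
have wA : wirth A by case: mA => f [wA _]; exists f.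
have rX := reflexive_unit_mul uB (wirth_reflexive wA).
set X := B *m A in h rX; have dX := reflexive_det rX.
pose l : 'rV[int]_n := usubmx U; pose r j := (l *m X) 0 j.
have rE j : (r j)%:~R = (toR R U *m toR R (col j X)) (lshift n2 0) 0.
  rewrite -toRM mxE; congr _%:~R; rewrite /r !mxE; apply: eq_bigr => k _.
  by rewrite !mxE.
have img j : r j = 0 \/ exists b : bool,
    toR R U *m toR R (col j X) = col_mx (const_mx ((-1) ^+ b)) 0.
  have /h /vertex_freesum_segW [[b e]|[q [_ _ e]]] : vertex (Pmx R X) (toR R (col j X)).
    by apply/vertex_Pmx => //; right; exists j, false; rewrite scale1r.
    by right; exists b.
  by left; apply/eqP; rewrite -(@intr_eq0 R) rE e col_mxEu mxE.
case: (pickP (fun j => r j != 0)) => [j rj|r0].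
  case: (img j) => [rj0|[b ej]]; first by rewrite rj0 eqxx in rj.
  (* A second column sent to an end of the segment would agree with the [j]-th up to sign. *)
  have rk k : k != j -> r k = 0.
    move=> kj; case: (img k) => // - [c ek]; case/eqP: kj.
    apply: (@col_scale_inj R _ X k j ((-1) ^+ (c (+) b))) => //.
    have inj (x y : 'cV[R]_n) : toR R U *m x = toR R U *m y -> x = y.
      move/(congr1 (mulmx (toR R V))); rewrite !mulmxA -toRM VU toR1.
      by rewrite !mul1mx.
    apply: inj; rewrite -scalemxAr ek ej scale_col_mx scaler0; congr col_mx.
    by apply/colP=> i; rewrite !mxE -signr_addb -addbA addbb addbF.
  have rj1 : r j = (-1) ^+ b.
    apply: (@intr_inj R); rewrite rE ej col_mxEu mxE.
    by rewrite rmorph_sign.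
  have := @wirth_1min_no_unit_row _ A (l *m B) j mA.
  rewrite -mulmxA -/X => /(_ rk); rewrite -/(r j) rj1; case: (b) => //.
(* If no column goes to the segment, [l] kills all columns and is 0, although it is a row of the
   invertible [U]. *)
have lX : l *m X = 0 by apply/rowP=> j; rewrite [RHS]mxE; apply/eqP/negbFE/r0.
have l0 : l = 0.
  case: rX => W [u [_ XW _]]; apply: (mulmx_left_inj XW).
  by rewrite lX mul0mx.
move/matrixP: UV => /(_ (lshift n2 0) (lshift n2 0)).
rewrite [LHS]mxE [RHS]mxE eqxx big1 => [/eqP|k _]; first by rewrite eq_sym oner_eq0.
have -> : U (lshift n2 0) k = l 0 k by rewrite mxE.
by rewrite l0 mxE mul0r.
Qed.

Lemma irreducible_dim0 (P : 'cV[R]_0 -> Prop) : one_irreducible P.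
Proof. by move=> [n2 [Q [_ [_ /iso_dim]]]]. Qed.

Lemma reduction_irreducible n (A : 'M[int]_n) : wirth A -> one_irreducible (Pmx R (reduction A)).
Proof.
move=> wA; case: (posnP #|kept A|) => [|k0].
  by move: (reduction A) => Y; move: #|kept A| Y => m Y m0; subst m; apply: irreducible_dim0.
rewrite -[reduction A]mul1mx; apply: wirth_1min_irreducible (unitmx1 _ _).
exact: reduction_1min.
Qed.

Lemma wirth_iso_reduction n (A : 'M[int]_n) : wirth A ->
  iso (Pmx R A) (Pmx R (unit_ext (num_single A) (reduction A))).
Proof.
move=> wA; have [phi bphi e] := wirth_reorder wA.
rewrite e; apply: iso_simultaneous_reindex => //.
  exact/reflexive_det/wirth_reflexive.
rewrite -e; exact/reflexive_det/reflexive_unit_ext/reflexive_reduction.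
Qed.
End FreeSums.

Theorem theorem2p2 (R : realType) (d : nat) (hd : (0 < d)%N) :
  (* (1a) A |-> P_A sends Wirth matrices to is_reflexive cs-crosspolytopes
     (for any lattice basis B) *)
  (forall (A B : 'M[int]_d), wirth A -> B \in unitmx ->
     is_reflexive (Pmx R (B *m A)) /\ cs_cross (Pmx R (B *m A))) /\
  (* (1b) well defined and injective on equivalence classes *)
  (forall (A A' B B' : 'M[int]_d), wirth A -> wirth A' ->
     B \in unitmx -> B' \in unitmx ->
     (mx_equiv A A' <-> iso (Pmx R (B *m A)) (Pmx R (B' *m A')))) /\
  (* (1c) surjective onto isomorphism classes *)
  (forall P : 'cV[R]_d -> Prop, is_reflexive P -> cs_cross P ->
     exists A : 'M[int]_d, wirth A /\ iso P (Pmx R A)) /\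
  (* (1d) inverse map via any facet *)
  (forall (P F : 'cV[R]_d -> Prop), is_reflexive P -> cs_cross P -> facet P F ->
     exists (B A : 'M[int]_d), B \in unitmx /\ wirth A /\
       (forall x, vertex F x <-> exists j, x = toR R (col j (B *m A))) /\
       same P (Pmx R (B *m A))) /\
  (* (2a) 1-minimal Wirth matrices <-> 1-irreducible *)
  (forall (A B : 'M[int]_d), wirth A -> B \in unitmx ->
     (wirth_1min A <-> one_irreducible (Pmx R (B *m A)))) /\
  (* (2b) existence and uniqueness of the splitting *)
  (forall P : 'cV[R]_d -> Prop, is_reflexive P -> cs_cross P ->
     (exists d' (P' : 'cV[R]_d' -> Prop) (r : nat),
        is_reflexive P' /\ cs_cross P' /\ one_irreducible P' /\
        splits_segs P P' r) /\
     (forall d1 (P1 : 'cV[R]_d1 -> Prop) r1 d2 (P2 : 'cV[R]_d2 -> Prop) r2,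
        is_reflexive P1 -> cs_cross P1 -> one_irreducible P1 ->
        splits_segs P P1 r1 ->
        is_reflexive P2 -> cs_cross P2 -> one_irreducible P2 ->
        splits_segs P P2 r2 ->
        r1 = r2 /\ iso P1 P2) /\
     (* (2c) description via the reduction of a Wirth matrix of P *)
     (forall (A : 'M[int]_d) d' (P' : 'cV[R]_d' -> Prop) (r : nat),
        wirth A -> iso P (Pmx R A) ->
        is_reflexive P' -> cs_cross P' -> one_irreducible P' ->
        splits_segs P P' r ->
        r = num_single A /\ iso P' (Pmx R (reduction A)) /\
        ((0 < #|kept A|)%N -> wirth_1min (reduction A)))).
Proof.
have unitmul_iso (A B : 'M[int]_d) : wirth A -> B \in unitmx ->
    iso (Pmx R A) (Pmx R (B *m A)).
  move=> /wirth_reflexive rA uB; apply: mx_equiv_iso (mx_equiv_mull _ uB).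
    exact: reflexive_det.
  exact/reflexive_det/reflexive_unit_mul.
have surj (P : 'cV[R]_d -> Prop) : is_reflexive P -> cs_cross P ->
    exists A : 'M[int]_d, wirth A /\ iso P (Pmx R A).
  move=> rP cP; have [V rV PV] := reflexive_cs_cross rP cP.
  have [B [A [s [uB wA e]]]] := wirth_form hd rV; exists A; split=> //.
  apply: iso_trans (iso_same PV) _; apply: iso_trans (iso_sym (unitmul_iso A B wA uB)).
  rewrite -e; apply: mx_equiv_iso; try exact/reflexive_det/reflexive_perm.
    exact: reflexive_det.
  by exists 1%:M, s; rewrite unitmx1 mul1mx.
(* Every splitting is compared with the one read off from a Wirth matrix; uniqueness follows by
   comparing two splittings with the same [A]. *)
have red_irr (A : 'M[int]_d) n (P' : 'cV[R]_n -> Prop) (P : 'cV[R]_d -> Prop) r :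
    wirth A -> iso P (Pmx R A) -> is_reflexive P' -> cs_cross P' -> one_irreducible P' ->
    splits_segs P P' r -> r = num_single A /\ iso P' (Pmx R (reduction A)).
  move=> wA iA rP' cP' irr sp; have [Y rY PY] := reflexive_cs_cross rP' cP'.
  have iY := iso_same PY; have iE := splits_segs_unit_ext sp rY iY.
  have [|||| h1 h2] := @unit_ext_unique R r (num_single A) _ _ Y (reduction A) rY.
  - exact: reflexive_reduction.
  - exact: one_irreducible_iso iY irr.
  - exact: reduction_irreducible.
  - exact: iso_trans (iso_sym iE) (iso_trans iA (wirth_iso_reduction R wA)).
  by split=> //; apply: iso_trans iY h2.
split.
  move=> A B wA uB; have rX := reflexive_unit_mul uB (wirth_reflexive wA).
  by split; [exact: reflexive_Pmx | exists (B *m A); split=> //; exact: reflexive_det].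
split.
  move=> A A' B B' wA wA' uB uB'; split=> [eA|i].
    apply: iso_trans (iso_sym (unitmul_iso A B wA uB)) _.
    apply: iso_trans (unitmul_iso A' B' wA' uB').
    by apply: mx_equiv_iso eA; exact/reflexive_det/wirth_reflexive.
  apply: (iso_mx_equiv (R := R)); try exact: wirth_reflexive.
  exact: iso_trans (unitmul_iso A B wA uB) (iso_trans i (iso_sym (unitmul_iso A' B' wA' uB'))).
split; first exact: surj.
split.
  move=> P F rP cP fF; have [B [A [uB wA vF PA]]] := facet_wirth hd rP cP fF.
  by exists B, A.
split.
  move=> A B wA uB; split=> [mA|irr]; first exact: wirth_1min_irreducible.
  apply/(wirth_1min_single wA); case e : (num_single A) => [//|r].
  case: irr; exists (r + #|kept A|)%N, (Pmx R (unit_ext r (reduction A))).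
  apply: splits_seg_block1; first exact/reflexive_unit_ext/reflexive_reduction.
  apply: iso_trans (iso_sym (unitmul_iso A B wA uB)) _.
  by have := wirth_iso_reduction R wA; rewrite e.
move=> P rP cP; have [A [wA iA]] := surj P rP cP; split; last split.
- exists #|kept A|, (Pmx R (reduction A)), (num_single A).
  have rred := reflexive_reduction wA.
  split; first exact: reflexive_Pmx.
  split; first by exists (reduction A); split=> //; exact: reflexive_det.
  split; first exact: reduction_irreducible.
  apply: unit_ext_splits_segs rred _; exact: iso_trans iA (wirth_iso_reduction R wA).
- move=> d1 P1 r1 d2 P2 r2 rP1 cP1 irr1 s1 rP2 cP2 irr2 s2.
  have [-> i1] := red_irr A _ P1 P r1 wA iA rP1 cP1 irr1 s1.
  have [-> i2] := red_irr A _ P2 P r2 wA iA rP2 cP2 irr2 s2.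
  by split=> //; apply: iso_trans i1 (iso_sym i2).
move=> A' d' P' r wA' iA' rP' cP' irr' s'.
have [-> i'] := red_irr A' _ P' P r wA' iA' rP' cP' irr' s'.
by split=> //; split=> // ?; apply: reduction_1min.
Qed.
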